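(* Let $f:\mathbb{H}\to\mathbb{H}$ be an entire slice-regular function. If $f$ is bounded, then $f$ is constant. If the spherical derivative $f'_s$ is bounded (equivalently, if $\overline\partial_{CRF}f$ is bounded), then $f$ is a quaternionic left-affine function, of the form $f(x)=a+xb$ with $a,b\in\mathbb{H}$.
   Context: $\mathbb{H}$ is the algebra of quaternions $x=x_0+x_1i+x_2j+x_3k$, with conjugation $\overline x=x_0-x_1i-x_2j-x_3k$, $\operatorname{Im}(x)=x_1i+x_2j+x_3k$, $\mathbb{S}_{\mathbb{H}}=\{J\in\mathbb{H}:J^2=-1\}$, and $\overline\partial_{CRF}=\frac{\partial}{\partial x_0}+i\frac{\partial}{\partial x_1}+j\frac{\partial}{\partial x_2}+k\frac{\partial}{\partial x_3}$. A stem function on $\mathbb{C}$ is a map $F=F_1+\imath F_2:\mathbb{C}\to\mathbb{H}\otimes_{\mathbb{R}}\mathbb{C}$ ($F_1,F_2$ being $\mathbb{H}$-valued, $\imath^2=-1$) with $F(\overline z)=\overline{F(z)}$, where $\overline{a+\imath b}=a-\imath b$ for $a,b\in\mathbb{H}$. It induces the (left) slice function $f=\mathcal{I}(F):\mathbb{H}\to\mathbb{H}$, $f(\alpha+J\beta)=F_1(z)+JF_2(z)$ for $z=\alpha+\sqrt{-1}\,\beta$, $J\in\mathbb{S}_{\mathbb{H}}$. An entire slice-regular function on $\mathbb{H}$ is such an $f$ with $F$ holomorphic on $\mathbb{C}$ (with respect to the complex structure given by $\imath$). The spherical derivative of $f$ is $f'_s(x)=\frac12\operatorname{Im}(x)^{-1}(f(x)-f(\overline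 x))$ for $x\notin\mathbb{R}$; for $f$ slice-regular it extends continuously to real points. *)

(* Defs.v *)
From HB Require Import structures.
From mathcomp Require Import all_boot all_order all_algebra.
From mathcomp Require Import complex ring.
From mathcomp Require Import all_classical all_reals all_analysis.

Set Implicit Arguments.
Unset Strict Implicit.
Unset Printing Implicit Defensive.
Import Order.TTheory GRing.Theory Num.Theory.
Import numFieldNormedType.Exports.
Local Open Scope classical_set_scope.
Local Open Scope ring_scope.

(* Quaternions over K, as rows of coordinates with respect to 1, i, j, k.
   For K = R this is the algebra H; for K = R[i] it is the tensor product of H
   and C over the reals, where the imaginary unit of R[i] is the unit called
   iota in the theory of stem functions (not the quaternion i). *)
Definition quat (K : Type) := 'rV[K]_4.

HB.instance Definition _ (K : choiceType) := Choice.on (quat K).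
HB.instance Definition _ (K : zmodType) := GRing.Zmodule.on (quat K).
HB.instance Definition _ (K : nzRingType) := GRing.Lmodule.on (quat K).
(* The norm of this structure is the maximum norm on coordinates; only its
   topology is used below, for limits and derivatives. *)
HB.instance Definition _ (K : numFieldType) := NormedModule.on (quat K).

Section QuatRing.
Variable K : comNzRingType.
Implicit Types x y z : quat K.

Definition mkquat (a b c d : K) : quat K := \row_m [:: a; b; c; d]`_m.

Definition quat0 x : K := x ord0 (@Ordinal 4 0 isT).
Definition quat1 x : K := x ord0 (@Ordinal 4 1 isT).
Definition quat2 x : K := x ord0 (@Ordinal 4 2 isT).
Definition quat3 x : K := x ord0 (@Ordinal 4 3 isT).

Definition mulquat x y : quat K := mkquat
  (quat0 x * quat0 y - quat1 x * quat1 y - quat2 x * quat2 y - quat3 x * quat3 y)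
  (quat0 x * quat1 y + quat1 x * quat0 y + quat2 x * quat3 y - quat3 x * quat2 y)
  (quat0 x * quat2 y - quat1 x * quat3 y + quat2 x * quat0 y + quat3 x * quat1 y)
  (quat0 x * quat3 y + quat1 x * quat2 y - quat2 x * quat1 y + quat3 x * quat0 y).

Lemma quatP x y : quat0 x = quat0 y -> quat1 x = quat1 y ->
  quat2 x = quat2 y -> quat3 x = quat3 y -> x = y.
Proof.
move=> h0 h1 h2 h3; apply/rowP => -[[|[|[|[|m]]]] hm] //.
- by rewrite (bool_irrelevance hm isT).
- by rewrite (bool_irrelevance hm isT).
- by rewrite (bool_irrelevance hm isT).
- by rewrite (bool_irrelevance hm isT).
Qed.

Lemma quat0_mk a b c d : quat0 (mkquat a b c d) = a. Proof. exact: mxE. Qed.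
Lemma quat1_mk a b c d : quat1 (mkquat a b c d) = b. Proof. exact: mxE. Qed.
Lemma quat2_mk a b c d : quat2 (mkquat a b c d) = c. Proof. exact: mxE. Qed.
Lemma quat3_mk a b c d : quat3 (mkquat a b c d) = d. Proof. exact: mxE. Qed.
Definition quat_mkE := (quat0_mk, quat1_mk, quat2_mk, quat3_mk).

Lemma quat0D x y : quat0 (x + y) = quat0 x + quat0 y. Proof. exact: mxE. Qed.
Lemma quat1D x y : quat1 (x + y) = quat1 x + quat1 y. Proof. exact: mxE. Qed.
Lemma quat2D x y : quat2 (x + y) = quat2 x + quat2 y. Proof. exact: mxE. Qed.
Lemma quat3D x y : quat3 (x + y) = quat3 x + quat3 y. Proof. exact: mxE. Qed.
Definition quatDE := (quat0D, quat1D, quat2D, quat3D).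

Fact mulquatA : associative mulquat.
Proof. by move=> x y z; apply: quatP; rewrite !quat_mkE; ring. Qed.

Fact mul1quat : left_id (mkquat 1 0 0 0) mulquat.
Proof. by move=> x; apply: quatP; rewrite !quat_mkE; ring. Qed.

Fact mulquat1 : right_id (mkquat 1 0 0 0) mulquat.
Proof. by move=> x; apply: quatP; rewrite !quat_mkE; ring. Qed.

Fact mulquatDl : left_distributive mulquat +%R.
Proof. by move=> x y z; apply: quatP; rewrite !quatDE !quat_mkE !quatDE; ring. Qed.

Fact mulquatDr : right_distributive mulquat +%R.
Proof. by move=> x y z; apply: quatP; rewrite !quatDE !quat_mkE !quatDE; ring. Qed.

Fact quat_oner_neq0 : mkquat 1 0 0 0 != 0.
Proof.
by apply/eqP => /(congr1 quat0)/eqP; rewrite quat0_mk [quat0 _]mxE oner_eq0.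
Qed.

HB.instance Definition _ := GRing.Zmodule_isNzRing.Build (quat K)
  mulquatA mul1quat mulquat1 mulquatDl mulquatDr quat_oner_neq0.

Definition quat_i : quat K := mkquat 0 1 0 0.
Definition quat_j : quat K := mkquat 0 0 1 0.
Definition quat_k : quat K := mkquat 0 0 0 1.

Definition quat_conj x : quat K :=
  mkquat (quat0 x) (- quat1 x) (- quat2 x) (- quat3 x).
Definition quat_Im x : quat K := mkquat 0 (quat1 x) (quat2 x) (quat3 x).

Definition quat_sqnorm x : K :=
  quat0 x ^+ 2 + quat1 x ^+ 2 + quat2 x ^+ 2 + quat3 x ^+ 2.

End QuatRing.

Section QuatInverse.
Variable R : realFieldType.
Implicit Types x y : quat R.

Definition invquat x : quat R := (quat_sqnorm x)^-1 *: quat_conj x.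

Lemma quat_sqnorm_eq0 x : (quat_sqnorm x == 0) = (x == 0).
Proof.
apply/eqP/eqP => [|->]; last first.
  by rewrite /quat_sqnorm /quat0 /quat1 /quat2 /quat3 !mxE expr0n /= !addr0.
move/eqP; rewrite /quat_sqnorm !paddr_eq0 ?addr_ge0 ?sqr_ge0 // !sqrf_eq0.
move=> /andP[/andP[/andP[/eqP h0 /eqP h1] /eqP h2] /eqP h3].
by apply: quatP; rewrite ?h0 ?h1 ?h2 ?h3 [RHS]mxE.
Qed.

Let quatZE := ((fun a x => mxE _ _ _ _ : quat0 (a *: x) = a * quat0 x),
               (fun a x => mxE _ _ _ _ : quat1 (a *: x) = a * quat1 x),
               (fun a x => mxE _ _ _ _ : quat2 (a *: x) = a * quat2 x),
               (fun a x => mxE _ _ _ _ : quat3 (a *: x) = a * quat3 x)).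

Fact mulVquat : {in [pred x : quat R | x != 0], left_inverse 1 invquat *%R}.
Proof.
move=> x /=; rewrite inE -quat_sqnorm_eq0 /quat_sqnorm => nz.
by apply: quatP; rewrite /invquat /quat_sqnorm !quat_mkE !quatZE !quat_mkE;
  field.
Qed.

Fact mulquatV : {in [pred x : quat R | x != 0], right_inverse 1 invquat *%R}.
Proof.
move=> x /=; rewrite inE -quat_sqnorm_eq0 /quat_sqnorm => nz.
by apply: quatP; rewrite /invquat /quat_sqnorm !quat_mkE !quatZE !quat_mkE;
  field.
Qed.

Fact quat_unitP x y :
  y * x = 1 /\ x * y = 1 -> x \in [pred x : quat R | x != 0].
Proof.
move=> [yx _]; rewrite inE; apply/eqP => x0.
by move/eqP: yx; rewrite x0 mulr0 eq_sym oner_eq0.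
Qed.

Fact invquat_out : {in [predC [pred x : quat R | x != 0]], invquat =1 id}.
Proof.
move=> x; rewrite !inE negbK => /eqP ->; rewrite /invquat.
have /eqP -> : quat_sqnorm (0 : quat R) == 0 by rewrite quat_sqnorm_eq0.
by rewrite invr0 scale0r.
Qed.

HB.instance Definition _ := GRing.NzRing_hasMulInverse.Build (quat R)
  mulVquat mulquatV quat_unitP invquat_out.

End QuatInverse.

Section SliceFunctions.
Variable R : realType.
Local Notation H := (quat R).
Local Notation HC := (quat R[i]).
Implicit Types (F : R[i] -> HC) (f : H -> H) (x : H).

Definition quat_norm x : R := Num.sqrt (quat_sqnorm x).

Definition quat_bounded f := exists M : R, forall x, quat_norm (f x) <= M.

(* F = F_1 + iota F_2 *)
Definition stem_fst F (z : R[i]) : H := map_mx (@complex.Re R) (F z).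
Definition stem_snd F (z : R[i]) : H := map_mx (@complex.Im R) (F z).

(* conjugation a + iota b |-> a - iota b, with a and b in H *)
Definition stem_conj (w : HC) : HC := map_mx (@conjc R) w.

Definition is_stem F := forall z : R[i], F (conjc z) = stem_conj (F z).

(* complex differentiability at every point, for the structure of complex
   vector space on HC given by iota *)
Definition holomorphic_stem F :=
  forall z : R[i], derivable (F : R[i]^o -> HC) z 1.

Definition is_slice_of F f := forall (a b : R) (J : H), J ^+ 2 = -1 ->
  f (a *: (1 : H) + b *: J) =
  stem_fst F (Complex a b) + J * stem_snd F (Complex a b).

Definition entire_slice_regular f :=
  exists F, [/\ is_stem F, holomorphic_stem F & is_slice_of F f].

Definition sderiv_nonreal f x : H :=
  2^-1 *: ((quat_Im x)^-1 * (f x - f (quat_conj x))).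

Definition spherical_derivative f x : H :=
  if quat_Im x == 0
  then lim (sderiv_nonreal f y @[y --> within [set y | quat_Im y != 0] (nbhs x)])
  else sderiv_nonreal f x.

Definition dbar_CRF f x : H :=
  'D_1 f x + quat_i R * 'D_(quat_i R) f x
  + quat_j R * 'D_(quat_j R) f x + quat_k R * 'D_(quat_k R) f x.

End SliceFunctions.

(* Main.v *)
Require Import Defs.
From HB Require Import structures.
From mathcomp Require Import all_boot all_order all_algebra.
From mathcomp Require Import complex ring lra.
From mathcomp Require Import all_classical all_reals all_analysis.

Set Implicit Arguments.
Unset Strict Implicit.
Unset Printing Implicit Defensive.
Import Order.TTheory GRing.Theory Num.Theory.
Import numFieldNormedType.Exports.
Local Open Scope classical_set_scope.
Local Open Scope complex_scope.
Local Open Scope ring_scope.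

(** Write f as the slice function of a stem function F = F_1 + iota F_2, whose
    four coordinates are entire functions of one complex variable.  Everything
    rests on one theorem about an entire function g: if |Im g(z)| is at most
    M (1 + |z|), then g is affine ([Im_growth_affine]).

    Each of the three boundedness hypotheses bounds F_2 in this way.
    - If f is bounded, so is F_2, because i F_2(x + iota y) is half of
      f(x + y i) - f(x - y i).
    - On the slice of i, F_2(x + iota y) = y f'_s(x + y i).
    - On the same slice, y dbar_CRF f (x + y i) = - 2 F_2(x + iota y) for
      y > 0: the terms in the directions 1 and i cancel by the Cauchy-Riemann
      equations, and each of the directions j and k, which rotate the imaginary
      unit at first order, contributes - F_2(x + iota y).
    The coordinates of F are then affine, with real coefficients since F
    commutes with conjugation, so f(x) = a + x b.  For such an f one has
    f'_s = b and dbar_CRF f = - 2 b, which closes the equivalence, and a bounded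
    f must have b = 0.

    The proof of [Im_growth_affine] uses only derivatives at points, without
    continuity of the derivative.  Goursat's bisection argument ([goursat]) is
    run on antiderivatives: if A and B are antiderivatives of P and Q in the
    first and second variable and P_y = Q_x, then B - A has vanishing mixed
    second differences.  Applied to an entire K with period 2 pi iota, it shows
    that the mean of Re K over the period does not depend on the real part s of
    the variable; by the mean value theorem, Re K takes a common value on any
    two lines of constant s ([periodic_mean]).  Take
      K(zeta) = (g(w + z) - g(w)) (1/z - z/r^2)   with z = exp(zeta).
    As s tends to - oo, K tends to g'(w); on |z| = r the second factor is
    purely imaginary, so that Re K only involves Im (g(w + z) - g(w)).  This
    bounds g'(w) by 4/r times the maximum of |Im (g(w + z) - g(w))| on the
    circle ([cderiv_estimate]).  Linear growth of Im g thus makes g' bounded.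
    Then z |-> g(z + w) - g(z) has bounded imaginary part, so its derivative
    vanishes by the same estimate, and g' is constant. *)

Local Notation Re := complex.Re.
Local Notation Im := complex.Im.

(** * Closed forms on rectangles *)

Section RealGoursat.
Variable R : realType.
Implicit Types (x y a b h k : R).

(** The base point [a] of the integral is the reason for the half-line: the
    fundamental theorem of calculus applies to the right of it only. *)
Lemma antiderivative_above (u : R -> R) (a : R) : continuous u ->
  exists U : R -> R, forall x, a < x -> is_derive x 1 U (u x).
Proof.
move=> cu.
have iu x : (@lebesgue_measure R).-integrable `[a, x] (EFin \o u).
  apply: continuous_compact_integrable; first exact: segment_compact.
  exact: continuous_subspaceT.
eexists => x ax.
have x1 : x < x + 1 by rewrite ltrDl.
have [d e] := continuous_FTC1_closed x1 (iu _) ax (cu x).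
apply: DeriveDef d _.
by rewrite -e -derive1E.
Qed.

Lemma MVT_above (a : R) (f df : R -> R) (x h : R) :
  (forall t, a < t -> is_derive t 1 f (df t)) -> a < x -> 0 <= h ->
  exists2 c, x <= c <= x + h & f (x + h) - f x = df c * h.
Proof.
move=> fd ax h0.
have ge t : t \in `[x, x + h] -> a < t.
  by rewrite in_itv /= => /andP[xt _]; exact: lt_le_trans xt.
have [|t /subset_itv_oo_cc/ge/fd //||c] := @MVT_segment R f df x (x + h).
- by rewrite lerDl.
- by apply: derivable_within_continuous => t /ge/fd[].
- by rewrite in_itv /= => cx ->; exists c => //; congr (_ * _); ring.
Qed.

(** An additive function of the rectangle.  When [W = B - A], with [A] and [B]
    antiderivatives of [P] and [Q] in the first and second variable, it is the
    counterclockwise integral of [P dx + Q dy] over the boundary. *)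
Definition mixed_diff (W : R -> R -> R) (x y h k : R) : R :=
  W (x + h) (y + k) - W (x + h) y - W x (y + k) + W x y.

(** Additivity: the mixed difference is the sum of those of the four quarters, so
    one quarter carries at least a fourth of it. *)
Lemma bisect_rectangle (W : R -> R -> R) x y h k :
  0 <= h -> 0 <= k ->
  exists2 c : R * R, (x <= c.1 <= x + h / 2) && (y <= c.2 <= y + k / 2) &
   `|mixed_diff W x y h k| <= 4 * `|mixed_diff W c.1 c.2 (h / 2) (k / 2)|.
Proof.
move=> h0 k0.
set D := mixed_diff W.
have s : D x y h k = D x y (h/2) (k/2) + D (x + h/2) y (h/2) (k/2) +
  D x (y + k/2) (h/2) (k/2) + D (x + h/2) (y + k/2) (h/2) (k/2).
  rewrite /D /mixed_diff.
  have -> : x + h / 2 + h / 2 = x + h by field.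
  have -> : y + k / 2 + k / 2 = y + k by field.
  by ring.
have h2 : 0 <= h / 2 by rewrite divr_ge0.
have k2 : 0 <= k / 2 by rewrite divr_ge0.
have [g1|l1] := leP `|D x y h k| (4 * `|D x y (h/2) (k/2)|).
  by exists (x, y) => //=; apply/andP; split; apply/andP; split; lra.
have [g2|l2] := leP `|D x y h k| (4 * `|D (x + h/2) y (h/2) (k/2)|).
  by exists (x + h/2, y) => //=; apply/andP; split; apply/andP; split; lra.
have [g3|l3] := leP `|D x y h k| (4 * `|D x (y + k/2) (h/2) (k/2)|).
  by exists (x, y + k/2) => //=; apply/andP; split; apply/andP; split; lra.
have [g4|l4] := leP `|D x y h k| (4 * `|D (x + h/2) (y + k/2) (h/2) (k/2)|).
  by exists (x + h/2, y + k/2) => //=; apply/andP; split; apply/andP; split; lra.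
have n1 := ler_normD (D x y (h/2) (k/2) + D (x + h/2) y (h/2) (k/2) +
  D x (y + k/2) (h/2) (k/2)) (D (x + h/2) (y + k/2) (h/2) (k/2)).
have n2 := ler_normD (D x y (h/2) (k/2) + D (x + h/2) y (h/2) (k/2))
  (D x (y + k/2) (h/2) (k/2)).
have n3 := ler_normD (D x y (h/2) (k/2)) (D (x + h/2) y (h/2) (k/2)).
rewrite -s in n1; lra.
Qed.

(** Corners of nested intervals [c n, c n + h / 2 ^ n] converge to their common
    point, the supremum of the left ends. *)
Lemma halving_limit (c : nat -> R) (h : R) : 0 <= h ->
  (forall n, c n <= c n.+1 <= c n + h / 2 ^+ n / 2) ->
  exists l, forall n, c n <= l <= c n + h / 2 ^+ n.
Proof.
move=> h0 st.
have mono m n : c n <= c (n + m)%N.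
  elim: m => [|m IH]; first by rewrite addn0.
  by rewrite addnS; apply: le_trans IH _; have /andP[] := st (n + m)%N.
have dec m n : c (n + m)%N + h / 2 ^+ (n + m) <= c n + h / 2 ^+ n.
  elim: m => [|m IH]; first by rewrite addn0.
  apply: le_trans IH; rewrite addnS; have /andP[_] := st (n + m)%N.
  rewrite exprS invfM (mulrC 2^-1) mulrA; lra.
have pos n : 0 <= h / 2 ^+ n by rewrite divr_ge0 // exprn_ge0.
have ub m n : c m <= c n + h / 2 ^+ n.
  have [nm|/ltnW mn] := leqP n m.
    by rewrite -(subnKC nm); apply: le_trans _ (dec (m - n)%N n); rewrite lerDl.
  rewrite -(subnKC mn); apply: le_trans (mono (n - m)%N m) _.
  by rewrite lerDl.
exists (sup (range c)) => n; apply/andP; split.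
  apply: ub_le_sup; last by exists n.
  by exists (c 0 + h / 2 ^+ 0) => _ [m _ <-].
apply: ge_sup; first by exists (c 0%N), 0%N.
by move=> _ [m _ <-].
Qed.

(** Iterated bisection: the rectangles shrink to a point while the mixed
    difference decreases no faster than the area. *)
Lemma nested_rectangles (W : R -> R -> R) x y h k : 0 <= h -> 0 <= k ->
  exists l : R * R, [/\ x <= l.1, y <= l.2 &
   forall n, exists c : R * R,
    [/\ x <= c.1 <= l.1 /\ l.1 <= c.1 + h / 2 ^+ n,
        y <= c.2 <= l.2 /\ l.2 <= c.2 + k / 2 ^+ n &
     `|mixed_diff W x y h k| <=
       4 ^+ n * `|mixed_diff W c.1 c.2 (h / 2 ^+ n) (k / 2 ^+ n)|]].
Proof.
move=> h0 k0.
have step (nc : nat * (R * R)) : exists c' : R * R,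
  [/\ nc.2.1 <= c'.1 <= nc.2.1 + h / 2 ^+ nc.1 / 2,
     nc.2.2 <= c'.2 <= nc.2.2 + k / 2 ^+ nc.1 / 2 &
  `|mixed_diff W nc.2.1 nc.2.2 (h / 2 ^+ nc.1) (k / 2 ^+ nc.1)| <=
    4 * `|mixed_diff W c'.1 c'.2 (h / 2 ^+ nc.1.+1) (k / 2 ^+ nc.1.+1)|].
  case: nc => n c /=.
  have [||c' /andP[b1 b2] e] := @bisect_rectangle W c.1 c.2 (h / 2 ^+ n) (k / 2 ^+ n).
  - by rewrite divr_ge0 // exprn_ge0.
  - by rewrite divr_ge0 // exprn_ge0.
  exists c'; split => //.
  by rewrite exprS [(2 * _)^-1]invfM (mulrC 2^-1) !mulrA.
have [s sP] := choice step.
pose c := fix c n := if n is m.+1 then s (m, c m) else (x, y).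
have cS n : c n.+1 = s (n, c n) by [].
have [|l1 L1] := @halving_limit (fun n => (c n).1) h h0.
  by move=> n; have [] := sP (n, c n).
have [|l2 L2] := @halving_limit (fun n => (c n).2) k k0.
  by move=> n; have [] := sP (n, c n).
exists (l1, l2); split => /=.
- by have /andP[] := L1 0%N.
- by have /andP[] := L2 0%N.
move=> n; exists (c n).
have /andP[-> ->] := L1 n; have /andP[-> ->] := L2 n.
have g1 : x <= (c n).1.
  elim: n => [|n IH]; first exact: lexx.
  by apply: le_trans IH _; have [/andP[]] := sP (n, c n).
have g2 : y <= (c n).2.
  elim: n {g1} => [|n IH]; first exact: lexx.
  by apply: le_trans IH _; have [_ /andP[]] := sP (n, c n).
rewrite g1 g2; split => //.
elim: n {g1 g2} => [|n IH]; first by rewrite expr0 !divr1 mul1r.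
apply: le_trans IH _; rewrite exprSr -mulrA ler_wpM2l ?exprn_ge0 //.
by have [_ _] := sP (n, c n).
Qed.

Lemma ler_dist_itv (u h s t : R) :
  u <= s <= u + h -> u <= t <= u + h -> `|s - t| <= h.
Proof.
by move=> /andP[us su] /andP[ut tu]; rewrite ler_norml; apply/andP; split; lra.
Qed.

Lemma ler_norm_subl (e s t : R) : `|s| <= e -> `|t| <= e -> `|s - t| <= 2 * e.
Proof. by move=> se te; apply: le_trans (ler_normB _ _) _; lra. Qed.

(** Total (Frechet) differentiability of a function of two real variables, the
    partial derivatives being [p] and [q]. *)
Definition total_deriv (P : R -> R -> R) (p q x y : R) : Prop :=
  forall e, 0 < e -> exists2 d, 0 < d & forall h k, `|h| < d -> `|k| < d ->
   `|P (x + h) (y + k) - P x y - (p * h + q * k)| <= e * (`|h| + `|k|).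

(** Near the point selected by bisection, [P] and [Q] are affine up to an error
    [e'] times the diameter.  For affine [P] and [Q] the mixed difference is
    [(Q_x - P_y) H K = 0], so that over a rectangle with sides [H] and [K] it is
    at most [2 e' (H + K) ^ 2]; this is [4 ^ - n] times a multiple of [e'], and
    bisection loses only the factor [4 ^ n]. *)
Lemma goursat (a : R) (A B P Q : R -> R -> R) :
  (forall x y, a < x -> is_derive x 1 (A^~ y) (P x y)) ->
  (forall x y, a < y -> is_derive y 1 (B x) (Q x y)) ->
  (forall x y, exists p m q, total_deriv P p m x y /\ total_deriv Q m q x y) ->
  forall x y h k, a < x -> a < y -> 0 <= h -> 0 <= k ->
  mixed_diff (fun x y => B x y - A x y) x y h k = 0.
Proof.
move=> dA dB dPQ x y h k ax ay h0 k0.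
set W := fun _ _ => _.
have [[X Y] /= [xX yY nest]] := @nested_rectangles W x y h k h0 k0.
have [p [m [q [dP dQ]]]] := dPQ X Y.
apply/eqP; rewrite -normr_le0; apply/ler_addgt0Pr => e e0; rewrite add0r.
have s0 : 0 < 2 * (h + k) ^+ 2 + 1 by rewrite ltr_wpDl // mulr_ge0 // sqr_ge0.
have e'0 : 0 < e / (2 * (h + k) ^+ 2 + 1) by rewrite divr_gt0.
set e' := e / _ in e'0.
have [d1 d10 {}dP] := dP _ e'0; have [d2 d20 {}dQ] := dQ _ e'0.
have [d [d0 dd1 dd2]] : exists d, [/\ 0 < d, d <= d1 & d <= d2].
  by exists (Num.min d1 d2); rewrite lt_min d10 d20 !ge_min !lexx orbT.
have [n hn] : exists n : nat, (h + k) / 2 ^+ n < d.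
  exists (Num.bound ((h + k) / d)).
  set N := Num.bound _.
  rewrite ltr_pdivrMr ?exprn_gt0 // -ltr_pdivrMl // mulrC.
  have hk : (h + k) / d < N%:R.
    by apply: archi_boundP; rewrite divr_ge0 ?addr_ge0 // ltW.
  apply: lt_trans hk _.
  by rewrite -natrX ltr_nat ltn_expl.
have [[u v] /= [[/andP[xu uX] Xu] [/andP[yv vY] Yv] le]] := nest n.
have P2 : 0 < (2 : R) ^+ n by rewrite exprn_gt0.
have H0 : 0 <= h / 2 ^+ n by rewrite divr_ge0 // ltW.
have K0 : 0 <= k / 2 ^+ n by rewrite divr_ge0 // ltW.
rewrite mulrDl in hn.
have [H eH] : exists H, h / 2 ^+ n = H by eexists.
have [K eK] : exists K, k / 2 ^+ n = K by eexists.
rewrite eH eK in Xu Yv le H0 K0 hn.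
have au : a < u by apply: lt_le_trans xu.
have av : a < v by apply: lt_le_trans yv.
(* The mean value theorem turns the mixed differences of A and B into
   increments of P and Q inside the small rectangle. *)
have [|xi /andP[x1 x2] eA] := @MVT_above a (fun t => A t (v + K) - A t v)
    (fun t => P t (v + K) - P t v) u H _ au H0.
  by move=> t at_; apply: is_deriveB; exact: dA.
have [|et /andP[t1 t2] eB] := @MVT_above a (fun t => B (u + H) t - B u t)
    (fun t => Q (u + H) t - Q u t) v K _ av K0.
  by move=> t at_; apply: is_deriveB; exact: dB.
have E : mixed_diff W u v H K = (Q (u + H) et - Q u et) * K - (P xi (v + K) - P xi v) * H.
  by rewrite -eA -eB /mixed_diff /W; ring.
have near1 t s : u <= t <= u + H -> v <= s <= v + K ->
   `|P t s - P X Y - (p * (t - X) + m * (s - Y))| <= e' * (H + K) /\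
   `|Q t s - Q X Y - (m * (t - X) + q * (s - Y))| <= e' * (H + K).
  move=> tu sv.
  have tX : `|t - X| <= H by apply: ler_dist_itv tu _; rewrite uX Xu.
  have sY : `|s - Y| <= K by apply: ler_dist_itv sv _; rewrite vY Yv.
  have ts : e' * (`|t - X| + `|s - Y|) <= e' * (H + K).
    by rewrite ler_wpM2l ?lerD // ltW.
  have Hd : H < d by apply: le_lt_trans hn; rewrite lerDl.
  have Kd : K < d by apply: le_lt_trans hn; rewrite lerDr.
  have tXd := le_lt_trans tX Hd; have sYd := le_lt_trans sY Kd.
  have -> : P t s = P (X + (t - X)) (Y + (s - Y)) by rewrite !subrKC.
  have -> : Q t s = Q (X + (t - X)) (Y + (s - Y)) by rewrite !subrKC.
  split.
  - by apply: le_trans (dP _ _ _ _) ts; exact: lt_le_trans dd1.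
  - by apply: le_trans (dQ _ _ _ _) ts; exact: lt_le_trans dd2.
have uH : u <= u <= u + H by rewrite lexx lerDl.
have uH' : u <= u + H <= u + H by rewrite lexx lerDl H0.
have vK : v <= v <= v + K by rewrite lexx lerDl.
have vK' : v <= v + K <= v + K by rewrite lexx lerDl K0.
have xi' : u <= xi <= u + H by rewrite x1 x2.
have et' : v <= et <= v + K by rewrite t1 t2.
have [_ q1] := near1 _ _ uH' et'; have [_ q2] := near1 _ _ uH et'.
have [p1 _] := near1 _ _ xi' vK'; have [p2 _] := near1 _ _ xi' vK.
set eps := e' * (H + K) in q1 q2 p1 p2.
have qq : `|Q (u + H) et - Q u et - m * H| <= 2 * eps.
  by have := ler_norm_subl q1 q2; congr (`|_| <= _); ring.
have pp : `|P xi (v + K) - P xi v - m * K| <= 2 * eps.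
  by have := ler_norm_subl p1 p2; congr (`|_| <= _); ring.
have DW : `|mixed_diff W u v H K| <= 2 * e' * (H + K) ^+ 2.
  rewrite E.
  have -> : (Q (u + H) et - Q u et) * K - (P xi (v + K) - P xi v) * H =
    (Q (u + H) et - Q u et - m * H) * K - (P xi (v + K) - P xi v - m * K) * H by ring.
  apply: le_trans (ler_normB _ _) _; rewrite !normrM (ger0_norm H0) (ger0_norm K0).
  apply: le_trans (lerD (ler_wpM2r K0 qq) (ler_wpM2r H0 pp)) _.
  by rewrite /eps le_eqVlt; apply/orP; left; apply/eqP; ring.
apply: le_trans le _.
apply: le_trans (ler_wpM2l _ DW) _; first by rewrite exprn_ge0.
have -> : 4 ^+ n * (2 * e' * (H + K) ^+ 2) = e' * (2 * (h + k) ^+ 2).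
  have -> : (4 : R) ^+ n = 2 ^+ n * 2 ^+ n by rewrite -exprMn; congr (_ ^+ _); ring.
  by rewrite -eH -eK; field; rewrite gt_eqF.
by rewrite /e' mulrAC ler_pdivrMr // ler_wpM2l ?lerDl // ltW.
Qed.

End RealGoursat.

(** * Complex derivatives and the exponential *)

Section Derivatives.

(** Differentiability along a line as a first-order estimate, over any numeric
    field: it is used over [R], over [R[i]], and for vector-valued functions. *)
Lemma is_deriveP (K : numFieldType) (U V : normedModType K) (f : U -> V) x v l :
  is_derive x v f l <->
  forall e : K, 0 < e -> exists2 d : K, 0 < d & forall h : K, `|h| < d ->
    `|f (x + h *: v) - f x - h *: l| <= e * `|h|.
Proof.
split=> [[fd <-] e e0|fl].
  move/cvgrPdist_le: fd => /(_ e e0) [d /= d0 fd].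
  exists d => // h hd; have [->|h0] := eqVneq h 0.
    by rewrite !scale0r addr0 subrr subr0 !normr0 mulr0.
  have := fd h; rewrite /ball_ /= sub0r normrN => /(_ hd h0).
  rewrite -(ler_pM2r (_ : 0 < `|h|)) ?normr_gt0 // -[X in X <= _]mulrC -normrZ.
  by rewrite scalerBr scalerA divff // scale1r distrC (addrC x).
have c : h^-1 *: (f (h *: v + x) - f x) @[h --> 0^'] --> l.
  apply/cvgrPdist_le => e /fl [d d0 {}fl]; exists d => //= h.
  rewrite /ball_ /= sub0r normrN => hd h0.
  rewrite -(ler_pM2r (_ : 0 < `|h|)) ?normr_gt0 // -[X in X <= _]mulrC -normrZ.
  by rewrite scalerBr scalerA divff // scale1r distrC (addrC _ x); exact: fl.
by apply: DeriveDef; [apply/cvg_ex; exists l | exact: cvg_lim].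
Qed.

Variable R : realType.
Local Notation C := R[i].

Definition cderiv (g : C -> C) (z c : C) : Prop :=
  is_derive (z : C^o) (1 : C^o) (g : C^o -> C^o) (c : C^o).

(** The same estimate with real constants and real-valued moduli, instead of
    elements of [R[i]] that happen to be real. *)
Lemma cderivP (g : C -> C) (z c : C) : cderiv g z c <->
  forall e : R, 0 < e -> exists2 d : R, 0 < d & forall h, Normc.normc h < d ->
    Normc.normc (g (z + h) - g z - c * h) <= e * Normc.normc h.
Proof.
split=> [/is_deriveP gc e e0|gc].
  have [|d d0 {}gc] := gc e%:C; first by rewrite (ltcR 0).
  have rd : d = (Re d)%:C by rewrite RRe_real // gtr0_real.
  exists (Re d); first by rewrite -ltcR -rd.
  move=> h hd; rewrite -lecR rmorphM /=.
  have := gc h; rewrite {1}rd [`|h| < _]ltcR => /(_ hd).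
  by rewrite [h *: (1 : C^o)]mulr1 [h *: (c : C^o)]mulrC.
apply/is_deriveP => e e0.
have re : e = (Re e)%:C by rewrite RRe_real // gtr0_real.
have [|d d0 {}gc] := gc (Re e); first by rewrite -ltcR -re.
exists d%:C; first by rewrite (ltcR 0).
move=> h; rewrite [`|h| < _]ltcR => /gc; rewrite -lecR rmorphM /= -re.
by rewrite [h *: (1 : C^o)]mulr1 [h *: (c : C^o)]mulrC.
Qed.

Local Notation normc := Normc.normc.

Lemma normc_ge0 (z : C) : 0 <= normc z.
Proof. by case: z => a b; exact: sqrtr_ge0. Qed.

Lemma normcD (z w : C) : normc (z + w) <= normc z + normc w.
Proof. exact: le_normcD. Qed.

Lemma normcB (z w : C) : normc (z - w) <= normc z + normc w.
Proof. by rewrite -[normc w]normcN; exact: le_normcD. Qed.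

Lemma Re_le_normc (z : C) : `|Re z| <= normc z.
Proof. by rewrite -lecR; exact: normc_ge_Re. Qed.

Lemma Im_le_normc (z : C) : `|Im z| <= normc z.
Proof.
case: z => a b /=; rewrite -[X in X <= _]sqrtr_sqr ler_sqrt ?lerDr ?sqr_ge0 //.
by rewrite addr_ge0 // sqr_ge0.
Qed.

Lemma normc_le_ReIm (z : C) : normc z <= `|Re z| + `|Im z|.
Proof.
rewrite -[X in X <= _]ger0_norm ?normc_ge0 // -ler_sqr ?nnegrE ?addr_ge0 //.
case: z => a b /=; rewrite ger0_norm ?sqrtr_ge0 // sqr_sqrtr ?addr_ge0 ?sqr_ge0 //.
by rewrite sqrrD !real_normK ?num_real // lerD2r lerDl mulrn_wge0 ?mulr_ge0 ?normr_ge0.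
Qed.

Lemma normc_real (x : R) : normc x%:C = `|x|.
Proof. by rewrite /= expr0n /= addr0 sqrtr_sqr. Qed.

Lemma cderiv_affine (g : C -> C) (a b z c : C) :
  cderiv g (a * z + b) c -> cderiv (fun z => g (a * z + b)) z (a * c).
Proof.
move=> /cderivP gc; apply/cderivP => e e0.
have a1 : 0 < normc a + 1 by rewrite ltr_wpDl // normc_ge0.
have [|d d0 {}gc] := gc (e / (normc a + 1)); first by rewrite divr_gt0.
exists (d / (normc a + 1)) => [|h]; first by rewrite divr_gt0.
rewrite ltr_pdivlMr // => hd.
have ah : normc (a * h) <= normc h * (normc a + 1).
  by rewrite Normc.normcM mulrC ler_wpM2l ?normc_ge0 // lerDl.
have -> : a * (z + h) + b = a * z + b + a * h by ring.
have -> : a * c * h = c * (a * h) by ring.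
apply: le_trans (gc _ (le_lt_trans ah hd)) _.
apply: le_trans (ler_wpM2l _ ah) _; first by rewrite divr_ge0 // ltW.
by rewrite mulrCA divfK ?gt_eqF // mulrC.
Qed.

Lemma cderivB (g1 g2 : C -> C) (z c1 c2 : C) :
  cderiv g1 z c1 -> cderiv g2 z c2 -> cderiv (fun z => g1 z - g2 z) z (c1 - c2).
Proof. exact: is_deriveB. Qed.

Lemma cderivM (g1 g2 : C -> C) (z c1 c2 : C) :
  cderiv g1 z c1 -> cderiv g2 z c2 ->
  cderiv (fun z => g1 z * g2 z) z (g1 z * c2 + g2 z * c1).
Proof. exact: is_deriveM. Qed.

(** With [m = 1] and [m = - iota] this differentiates the real and the imaginary
    part of [g] along a line, which brings in the mean value theorem. *)
Lemma cderiv_Re_line (g : C -> C) (a b m c : C) (t : R) :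
  cderiv g (a + t%:C * b) c ->
  is_derive t 1 (fun t : R => Re (m * g (a + t%:C * b))) (Re (m * (c * b))).
Proof.
move=> gc; have {}gc : cderiv (fun s => m * g (b * s + a)) t%:C (m * (b * c)).
  have := cderivM (_ : cderiv (fun=> m) t%:C 0) (@cderiv_affine g b a t%:C c _).
  rewrite mulr0 addr0; apply.
    exact: (@is_derive_cst C C^o C^o).
  by rewrite mulrC addrC.
apply/is_deriveP => e e0.
have /cderivP/(_ e e0) [d d0 {}gc] := gc.
exists d => // h hd.
have := gc h%:C; rewrite normc_real => /(_ hd); apply: le_trans.
apply: le_trans (Re_le_normc _).
rewrite [h *: 1]mulr1 [h *: Re _]mulrC.
set u := (X in _ <= `|X|).
suff -> : u = Re (m * g (a + (t + h)%:C * b)) - Re (m * g (a + t%:C * b)) -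
   Re (m * (c * b)) * h by [].
rewrite /u.
have -> : b * (t%:C + h%:C) + a = a + (t + h)%:C * b by rewrite rmorphD /=; ring.
have -> : b * t%:C + a = a + t%:C * b by ring.
rewrite (mulrC b c).
move: (m * g (a + (t + h)%:C * b)) (m * g (a + t%:C * b)) (m * (c * b)).
by move=> [x1 x2] [y1 y2] [z1 z2] /=; ring.
Qed.

Lemma cderiv0_cst (g : C -> C) : (forall z, cderiv g z 0) -> forall z, g z = g 0.
Proof.
move=> g0 z.
have H m : Re (m * g z) = Re (m * g 0).
  have /(_ 1 0)/= := @is_derive_0_is_cst R (fun t => Re (m * g (0 + t%:C * z))).
  rewrite !add0r mul1r mul0r; apply => t.
  have := @cderiv_Re_line g 0 z m 0 t (g0 _).
  by rewrite mul0r mulr0.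
have := H 1; rewrite !mul1r; have := H (- 'i)%C.
move: (g z) (g 0) => [x y] [x' y'] /= + ->.
by rewrite !(mul0r, sub0r, mulN1r, opprK, mul1r, oppr0) => ->.
Qed.

Definition cexp (z : C) : C := (expR (Re z))%:C * Complex (cos (Im z)) (sin (Im z)).

Lemma cexp0 : cexp 0 = 1.
Proof. by rewrite /cexp /= expR0 cos0 sin0 mul1r. Qed.

Lemma cexpD z w : cexp (z + w) = cexp z * cexp w.
Proof.
case: z w => [a b] [c d]; rewrite /cexp /= expRD cosD sinD.
by apply/eqP; rewrite eq_complex /=; apply/andP; split; apply/eqP; ring.
Qed.

Lemma normc_cexp z : normc (cexp z) = expR (Re z).
Proof.
rewrite /cexp Normc.normcM normc_real ger0_norm ?expR_ge0 //=.
by rewrite cos2Dsin2 sqrtr1 mulr1.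
Qed.

Lemma cexp_neq0 z : cexp z != 0.
Proof.
apply/eqP => /(congr1 (@Normc.normc R)); rewrite normc_cexp Normc.normc0 => /eqP.
by rewrite gt_eqF // expR_gt0.
Qed.

(** By the functional equation it is enough to differentiate at [0], where
    [exp h - 1 - h] is controlled by the first-order remainders of the real
    exponential, of cosine and of sine. *)
Lemma cderiv_cexp z : cderiv cexp z (cexp z).
Proof.
have at0 : cderiv cexp 0 1.
  apply/cderivP => e e0.
  have e4 : 0 < e / 4 by rewrite divr_gt0.
  have /is_deriveP/(_ _ e4) [d1 d10 D1] : is_derive (0 : R) 1 expR 1.
    by have := @is_derive_expR R 0; rewrite expR0.
  have /is_deriveP/(_ _ e4) [d2 d20 D2] : is_derive (0 : R) 1 (@cos R) 0.
    by have := @is_derive_cos R 0; rewrite sin0 oppr0.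
  have /is_deriveP/(_ _ e4) [d3 d30 D3] : is_derive (0 : R) 1 (@sin R) 1.
    by have := @is_derive_sin R 0; rewrite cos0.
  have s0 : 0 < 2 * (e / 4) + 1 by rewrite addr_gt0 // mulr_gt0.
  exists (Num.min (Num.min d1 d2) (Num.min d3 (e / 4 / (2 * (e / 4) + 1)))).
    by rewrite !lt_min d10 d20 d30 !divr_gt0.
  move=> h; rewrite !lt_min => /andP[/andP[h1 h2] /andP[h3 h4]].
  have ha := Re_le_normc h; have hb := Im_le_normc h.
  have := D1 _ (le_lt_trans ha h1).
  have := D2 _ (le_lt_trans hb h2).
  have := D3 _ (le_lt_trans hb h3).
  rewrite expR0 cos0 sin0 scaler0 !add0r !subr0 ![_ *: 1]mulr1 => S3 S2 S1.
  rewrite cexp0.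
  have cs : normc (Complex (cos (Im h)) (sin (Im h)) - Complex 1 (Im h)) <=
      2 * (e / 4) * normc h.
    apply: le_trans (normc_le_ReIm _) _ => /=.
    have -> : 2 * (e / 4) * normc h = e / 4 * normc h + e / 4 * normc h by ring.
    apply: lerD; [apply: le_trans S2 _ | apply: le_trans S3 _].
    - by rewrite ler_wpM2l // ltW.
    - by rewrite ler_wpM2l // ltW.
  have c1 : normc (Complex (cos (Im h)) (sin (Im h)) - 1) <=
      (2 * (e / 4) + 1) * normc h.
    have -> : Complex (cos (Im h)) (sin (Im h)) - 1 =
      (Complex (cos (Im h)) (sin (Im h)) - Complex 1 (Im h)) + Complex 0 (Im h).
      by apply/eqP; rewrite eq_complex /=; apply/andP; split; apply/eqP; ring.
    apply: le_trans (normcD _ _) _; rewrite mulrDl mul1r; apply: lerD => //.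
    by rewrite /= expr0n /= add0r sqrtr_sqr.
  have -> : cexp h - 1 - 1 * h =
      ((expR (Re h) - 1 - Re h)%:C * Complex (cos (Im h)) (sin (Im h))) +
      (Re h)%:C * (Complex (cos (Im h)) (sin (Im h)) - 1) +
      (Complex (cos (Im h)) (sin (Im h)) - Complex 1 (Im h)).
    rewrite /cexp; case: h {h1 h2 h3 h4 ha hb S1 S2 S3 cs c1} => a b /=.
    by apply/eqP; rewrite eq_complex /=; apply/andP; split; apply/eqP; ring.
  apply: le_trans (normcD _ _) _.
  have -> : e * normc h = e / 4 * normc h + e / 4 * normc h + 2 * (e / 4) * normc h.
    by field.
  apply: lerD cs; apply: le_trans (normcD _ _) _; apply: lerD.
    rewrite Normc.normcM normc_real /= cos2Dsin2 sqrtr1 mulr1.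
    by apply: le_trans S1 _; rewrite ler_wpM2l // ltW.
  rewrite Normc.normcM normc_real.
  apply: le_trans (ler_pM _ _ ha c1) _; rewrite ?normr_ge0 ?normc_ge0 //.
  rewrite [X in X <= _]mulrA ler_wpM2r ?normc_ge0 //.
  by rewrite -ler_pdivlMr // ltW.
apply/cderivP => e e0.
have N0 : 0 < normc (cexp z) by rewrite normc_cexp expR_gt0.
have /cderivP/(_ (e / normc (cexp z))) [|d d0 D] := at0; first by rewrite divr_gt0.
exists d => // h /D.
rewrite add0r cexpD.
rewrite cexp0 mulrAC ler_pdivlMr // mulrC -Normc.normcM.
by congr (normc _ <= _); ring.
Qed.

End Derivatives.

(** * Entire functions whose imaginary part grows linearly *)

Section Entire.
Variable R : realType.
Local Notation C := R[i].
Local Notation normc := (@Normc.normc R).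

Definition entire (g : C -> C) := forall z, exists c, cderiv g z c.

Lemma entire_cst (c : C) : entire (fun=> c).
Proof. by move=> z; exists 0; exact: (@is_derive_cst C C^o C^o). Qed.

Lemma entireB g1 g2 : entire g1 -> entire g2 -> entire (fun z => g1 z - g2 z).
Proof.
move=> h1 h2 z; have [c1 d1] := h1 z; have [c2 d2] := h2 z.
by exists (c1 - c2); exact: cderivB.
Qed.

Lemma entireM g1 g2 : entire g1 -> entire g2 -> entire (fun z => g1 z * g2 z).
Proof.
move=> h1 h2 z; have [c1 d1] := h1 z; have [c2 d2] := h2 z.
by eexists; exact: cderivM d1 d2.
Qed.

Lemma entire_affine g a b : entire g -> entire (fun z => g (a * z + b)).
Proof.
move=> h z; have [c d] := h (a * z + b).
by exists (a * c); exact: cderiv_affine.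
Qed.

Lemma entire_comp g1 g2 : entire g1 -> entire g2 -> entire (fun z => g1 (g2 z)).
Proof.
move=> h1 h2 z; have [c1 [d1 _]] := h1 (g2 z); have [c2 [d2 _]] := h2 z.
have D1 := (derivable1_diffP (g1 : C^o -> C^o) (g2 z)).1 d1.
have D2 := (derivable1_diffP (g2 : C^o -> C^o) z).1 d2.
have D := @differentiable_comp C C^o C^o C^o g2 g1 z D2 D1.
by eexists; apply/derivableP/(derivable1_diffP _ _).2; exact: D.
Qed.

(** The Cauchy-Riemann equations: [Im c] and [Re c] are the partial derivatives
    of [Im K], and [Re c] is also the first partial derivative of [Re K].  Hence
    [Im K dx + Re K dy] satisfies the hypothesis of [goursat]. *)
Lemma total_deriv_ReIm (K : C -> C) (x y : R) (c : C) :
  cderiv K (Complex x y) c ->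
  total_deriv (fun x y => Re (K (Complex x y))) (Re c) (- Im c) x y /\
  total_deriv (fun x y => Im (K (Complex x y))) (Im c) (Re c) x y.
Proof.
move=> /cderivP Kc; split=> e e0; have [d d0 {}Kc] := Kc e e0;
  exists (d / 2); rewrite ?divr_gt0 // => h k hd kd.
all: have hk : normc (Complex h k) <= `|h| + `|k| by exact: normc_le_ReIm.
all: have hkd : normc (Complex h k) < d
  by apply: le_lt_trans hk _; rewrite (splitr d) ltrD.
all: apply: le_trans (ler_wpM2l (ltW e0) hk); apply: le_trans (Kc _ hkd).
- apply: le_trans (Re_le_normc _).
  rewrite -[Complex x y + _]/(Complex (x + h) (y + k)).
  move: (K _) (K _) c {Kc} => [u1 u2] [v1 v2] [c1 c2] /=.
  by rewrite le_eqVlt; apply/orP; left; apply/eqP; congr `|_|; ring.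
- apply: le_trans (Im_le_normc _).
  rewrite -[Complex x y + _]/(Complex (x + h) (y + k)).
  move: (K _) (K _) c {Kc} => [u1 u2] [v1 v2] [c1 c2] /=.
  by rewrite le_eqVlt; apply/orP; left; apply/eqP; congr `|_|; ring.
Qed.

Lemma entire_line_continuous (K : C -> C) (a b m : C) : entire K ->
  continuous (fun t : R => Re (m * K (a + t%:C * b))).
Proof.
move=> hK t; have [c d] := hK (a + t%:C * b).
have [dd _] := cderiv_Re_line m d.
exact/differentiable_continuous/derivable1_diffP.
Qed.

(** Integrating [Im K dx + Re K dy] around a rectangle of height [2 pi], the
    horizontal sides cancel by periodicity, so the integrals of [Re K] over the
    two vertical sides agree.  Each is [2 pi] times a value of [Re K]. *)
Lemma periodic_mean (K : C -> C) : entire K ->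
  (forall z, K (z + Complex 0 (2 * pi)) = K z) ->
  forall s1 s2, s1 <= s2 -> exists t1 t2,
  Re (K (Complex s1 t1)) = Re (K (Complex s2 t2)).
Proof.
move=> hK per s1 s2 s12.
(* The rectangle [s1, s2] x [0, 2 pi] has to lie above a in both variables. *)
pose a := Num.min s1 0 - 1.
have a1 : a < s1 by rewrite ltrBlDr ltr_pwDr // ge_min lexx.
have a0 : a < 0 by rewrite ltrBlDr ltr_pwDr // ge_min lexx orbT.
pose P x y := Im (K (Complex x y)); pose Q x y := Re (K (Complex x y)).
have cP y : continuous (P^~ y).
  have -> : P^~ y = fun t : R => Re (Complex 0 (-1) * K (Complex 0 y + t%:C * 1)).
    apply/funext => t; rewrite /P mulr1 -[_ + _]/(Complex (0 + t) (y + 0)).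
    by rewrite add0r addr0; case: (K _) => u v /=; ring.
  exact: entire_line_continuous.
have cQ x : continuous (Q x).
  have -> : Q x = fun t : R => Re (1 * K (Complex x 0 + t%:C * Complex 0 1)).
    apply/funext => t; rewrite /Q mul1r; congr (Re (K _)).
    by apply/eqP; rewrite eq_complex /=; apply/andP; split; apply/eqP; ring.
  exact: entire_line_continuous.
have [A' dA] := choice (fun y => antiderivative_above a (cP y)).
have [B dB] := choice (fun x => antiderivative_above a (cQ x)).
have E : mixed_diff (fun x y => B x y - A' y x) s1 0 (s2 - s1) (2 * pi) = 0.
  apply: (@goursat R a (fun x y => A' y x) B P Q) => //.
  - by move=> x y; exact: dA.
  - move=> x y; have [c d] := hK (Complex x y).
    have [dQ dP] := total_deriv_ReIm d.
    by exists (Im c), (Re c), (- Im c).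
  - by rewrite subr_ge0.
  - by rewrite mulr_ge0 // pi_ge0.
rewrite /mixed_diff add0r subrKC in E.
have [||c _ eA] := @MVT_above R a (fun x => A' (2 * pi) x - A' 0 x)
  (fun x => P x (2 * pi) - P x 0) s1 (s2 - s1) _ a1.
- by move=> t at_; apply: is_deriveB; exact: dA.
- by rewrite subr_ge0.
have P0 : P c (2 * pi) = P c 0.
  rewrite /P -(per (Complex c 0)); congr (Im (K _)).
  by apply/eqP; rewrite eq_complex /=; apply/andP; split; apply/eqP; ring.
rewrite P0 subrr mul0r subrKC in eA.
have p0 : 0 < 2 * pi :> R by rewrite mulr_gt0 // pi_gt0.
have [|t1 _ e1] := @MVT_above R a (B s1) (Q s1) 0 (2 * pi) (dB s1) a0.
  exact: ltW.
have [|t2 _ e2] := @MVT_above R a (B s2) (Q s2) 0 (2 * pi) (dB s2) a0.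
  exact: ltW.
exists t1, t2; rewrite add0r in e1 e2.
apply: (mulIf (lt0r_neq0 p0)); rewrite -e1 -e2; lra.
Qed.

(** The kernel [1/z - z/r^2] has two effects: its first term makes the limit at
    [z = 0] equal to [c], and on the circle [|z| = r] it equals
    [- 2 iota Im z / r^2], so that only the imaginary part of [g] enters. *)
Lemma cderiv_Re_estimate (g : C -> C) (w c : C) (r M : R) : entire g ->
  cderiv g w c -> 0 < r ->
  (forall z, normc z = r -> `|Im (g (w + z) - g w)| <= M) ->
  `|Re c| <= 2 * M / r.
Proof.
move=> hg gc r0 hM.
pose K z := (g (w + cexp z) - g w) * (cexp (- z) - cexp z * (r%:C ^- 2)).
have hexp : entire (@cexp R) by move=> z; exists (cexp z); exact: cderiv_cexp.
have hK : entire K.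
  apply: entireM; apply: entireB.
  - apply: (@entire_comp (fun z => g (w + z)) (@cexp R)) => //.
    suff -> : (fun z => g (w + z)) = (fun z => g (1 * z + w)) by exact: entire_affine.
    by apply/funext => z; rewrite mul1r addrC.
  - exact: entire_cst.
  - suff -> : (fun z => cexp (- z)) = (fun z : C => cexp (-1 * z + 0)).
      exact: entire_affine.
    by apply/funext => z; rewrite mulN1r addr0.
  - by apply: entireM => //; exact: entire_cst.
have exp_per z : cexp (z + Complex 0 (2 * pi)) = cexp z.
  rewrite cexpD -[RHS]mulr1; congr (_ * _).
  by rewrite /cexp /= expR0 mul1r mulr_natl cos2pi sin2pi.
have per z : K (z + Complex 0 (2 * pi)) = K z.
  rewrite /K exp_per; congr (_ * (_ - _)).
  by rewrite -[LHS]exp_per; congr cexp; ring.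
have expN z : cexp (- z) = (cexp z)^-1 :> C.
  apply: (mulIf (cexp_neq0 z)); rewrite mulVf ?cexp_neq0 // -cexpD addNr.
  exact: cexp0.
apply/ler_addgt0Pr => e e0.
have e3 : 0 < e / 3 by rewrite divr_gt0.
have /cderivP/(_ _ e3) [d d0 D] := gc.
have c1 : 0 < normc c + 1 by rewrite ltr_wpDl // normc_ge0.
(* On |z| = rho, K differs from c by eta/z, eta z/r^2 and c z^2/r^2, where eta
   is the first-order remainder of g at w; rho makes each at most e / 3. *)
pose rho := Num.min (d / 2) (Num.min r (e / 3 * r / (normc c + 1))).
have rho0 : 0 < rho by rewrite !lt_min r0 !divr_gt0 // mulr_gt0.
have rhod : rho < d.
  by rewrite gt_min; apply/orP; left; rewrite ltr_pdivrMr // ltr_pMr // ltr1n.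
have rhor : rho <= r by rewrite !ge_min lexx orbT.
have rhoc : rho <= e / 3 * r / (normc c + 1) by rewrite !ge_min lexx !orbT.
have [|t1 [t2 E]] := @periodic_mean K hK per (ln rho) (ln r).
  by rewrite ler_ln.
have n1 : normc (cexp (Complex (ln rho) t1)) = rho by rewrite normc_cexp /= lnK.
have n2 : normc (cexp (Complex (ln r) t2)) = r by rewrite normc_cexp /= lnK.
have K2 : `|Re (K (Complex (ln r) t2))| <= 2 * M / r.
  rewrite /K expN; have := hM _ n2; move: (cexp_neq0 (Complex (ln r) t2)) n2.
  move: (cexp _) => [x y] z0 nz; move: (g _ - g _) => [u v] vM.
  have xy : x ^+ 2 + y ^+ 2 = r ^+ 2 by rewrite -nz sqr_sqrtr // addr_ge0 ?sqr_ge0.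
  have yr : `|y| <= r by rewrite -nz; exact: (Im_le_normc (Complex x y)).
  have -> : (Complex x y)^-1 - Complex x y * r%:C ^- 2 =
      Complex 0 (- (2 * y / r ^+ 2)).
    rewrite -rmorphXn -fmorphV; apply/eqP; rewrite eq_complex /= xy.
    by apply/andP; split; apply/eqP; field; rewrite gt_eqF.
  have -> : Re (Complex u v * Complex 0 (- (2 * y / r ^+ 2))) = 2 * (v * (y / r ^+ 2)).
    by rewrite /=; ring.
  have -> : 2 * M / r = 2 * (M * (r / r ^+ 2)) by field; rewrite gt_eqF.
  rewrite normrM ger0_norm // ler_wpM2l // !normrM.
  rewrite ler_pM ?mulr_ge0 ?normr_ge0 // [`|r ^- 2|]ger0_norm ?invr_ge0 ?sqr_ge0 //.
  by rewrite ler_wpM2r ?invr_ge0 ?sqr_ge0.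
have K1 : `|Re (K (Complex (ln rho) t1)) - Re c| <= e.
  rewrite -raddfB; apply: le_trans (Re_le_normc _) _.
  rewrite /K expN; move: (cexp_neq0 (Complex (ln rho) t1)) n1.
  move: (cexp _) => z z0 nz.
  have := D z; rewrite nz => /(_ rhod) Dz.
  have r2 : r%:C != 0 :> C by rewrite fmorph_eq0 gt_eqF.
  have -> : (g (w + z) - g w) * (z^-1 - z * r%:C ^- 2) - c =
     (g (w + z) - g w - c * z) * z^-1
     - (g (w + z) - g w - c * z) * z * r%:C ^- 2 - c * z ^+ 2 * r%:C ^- 2.
    by field; rewrite z0 r2.
  set eta := _ - _ - c * z in Dz *.
  have -> : e = e / 3 + e / 3 + e / 3 by field.
  have rho_r : rho / r <= 1 by rewrite ler_pdivrMr // mul1r.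
  have nr : normc (r%:C ^- 2) = r ^- 2.
    by rewrite -rmorphXn -fmorphV normc_real ger0_norm // invr_ge0 sqr_ge0.
  apply: le_trans (normcB _ _) _; apply: lerD; last first.
    rewrite !Normc.normcM nr nz.
    have -> : normc c * (rho * rho) / r ^+ 2 = (normc c * rho / r) * (rho / r).
      by field; rewrite gt_eqF.
    rewrite -[e / 3]mulr1; apply: ler_pM => //.
    - by rewrite !mulr_ge0 ?normc_ge0 ?invr_ge0 // ltW.
    - by rewrite divr_ge0 // ltW.
    rewrite ler_pdivrMr // mulrC; move: rhoc; rewrite ler_pdivlMr //.
    by apply: le_trans; rewrite ler_wpM2l ?lerDl // ltW.
  apply: le_trans (normcB _ _) _; rewrite !Normc.normcM Normc.normcV nr nz.
  apply: lerD; first by rewrite ler_pdivrMr.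
  have -> : normc eta * rho / r ^+ 2 = (normc eta / r) * (rho / r).
    by field; rewrite gt_eqF.
  rewrite -[e / 3]mulr1; apply: ler_pM => //.
  - by rewrite divr_ge0 ?normc_ge0 // ltW.
  - by rewrite divr_ge0 // ltW.
  rewrite ler_pdivrMr //; apply: le_trans Dz _.
  by rewrite ler_wpM2l // ltW.
rewrite E in K1.
have -> : Re c = Re (K (Complex (ln r) t2)) - (Re (K (Complex (ln r) t2)) - Re c) by ring.
by apply: le_trans (ler_normB _ _) _; exact: lerD.
Qed.

(** Precomposing with the rotation [z |-> iota z] preserves the circle and turns
    the real part of the derivative into its imaginary part. *)
Lemma cderiv_estimate (g : C -> C) (w c : C) (r M : R) : entire g ->
  cderiv g w c -> 0 < r ->
  (forall z, normc z = r -> `|Im (g (w + z) - g w)| <= M) ->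
  normc c <= 4 * M / r.
Proof.
move=> hg gc r0 hM.
apply: le_trans (normc_le_ReIm c) _.
have -> : 4 * M / r = 2 * M / r + 2 * M / r by ring.
apply: lerD; first exact: cderiv_Re_estimate hM.
have := @cderiv_Re_estimate (fun z => g (Complex 0 1 * z + w)) 0 (Complex 0 1 * c) r M.
have -> : `|Re (Complex 0 1 * c)| = `|Im c|.
  by case: (c) => u v /=; rewrite -normrN; congr `|_|; ring.
apply => //; first exact: entire_affine.
  by apply: cderiv_affine; rewrite mulr0 add0r.
move=> z zr; rewrite add0r mulr0 add0r [_ * z + w]addrC; apply: hM.
by rewrite Normc.normcM zr /= expr0n expr1n add0r sqrtr1 mul1r.
Qed.

(** [cderiv_estimate] is used twice.  On circles of radius proportional to
    [1 + |w|] it bounds [dg w] uniformly.  The mean value theorem then bounds the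
    imaginary part of [z |-> g (z + w) - g z], and circles of growing radius show
    that the derivative [dg w - dg 0] of this increment at [0] vanishes. *)
Lemma Im_growth_affine (g : C -> C) (M : R) : entire g ->
  (forall z, `|Im (g z)| <= M * (1 + normc z)) ->
  exists a c : C, forall z, g z = a + c * z.
Proof.
move=> hg hM; have [dg gd] := choice hg.
have M0 : 0 <= M.
  by have := hM 0; rewrite Normc.normc0 addr0 mulr1; apply: le_trans.
(* The radius is chosen proportional to 1 + |w|, so that the linear growth of
   Im g gives a bound independent of w. *)
have dgM w : normc (dg w) <= 8 * M.
  have w0 := normc_ge0 w.
  have r0 : 0 < 2 + 2 * normc w by rewrite ltr_pwDl // mulr_ge0.
  have -> : 8 * M = 4 * (M * (2 * (2 + 2 * normc w))) / (2 + 2 * normc w).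
    by field; rewrite gt_eqF.
  apply: cderiv_estimate hg (gd w) r0 _ => z zr.
  rewrite raddfB; apply: le_trans (ler_normB _ _) _.
  apply: le_trans (lerD (hM _) (hM _)) _; rewrite -mulrDr ler_wpM2l //.
  by have := normcD w z; rewrite zr; lra.
have incr (w z : C) : `|Im (g (z + w) - g z)| <= 8 * M * normc w.
  pose phi (t : R) := Re (Complex 0 (-1) * g (z + t%:C * w)).
  have dphi (t : R) : is_derive t 1 phi (Re (Complex 0 (-1) * (dg (z + t%:C * w) * w))).
    exact: cderiv_Re_line.
  have [|t _] := @MVT_above R (-1) phi _ 0 1 (fun t _ => dphi t) _ ler01.
    by rewrite ltrN10.
  have -> : phi (0 + 1) - phi 0 = Im (g (z + w) - g z).
    rewrite /phi add0r mul1r mul0r addr0.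
    by move: (g _) (g _) => [u1 u2] [v1 v2] /=; ring.
  rewrite mulr1 => ->; apply: le_trans (Re_le_normc _) _.
  rewrite !Normc.normcM /= expr0n sqrrN expr1n add0r sqrtr1 mul1r.
  by rewrite ler_wpM2r ?normc_ge0.
have dg_cst w : dg w = dg 0.
  pose h z := g (1 * z + w) - g z.
  have hh : entire h by apply: entireB => //; exact: entire_affine.
  have dh : cderiv h 0 (dg w - dg 0).
    apply: cderivB => //; rewrite -[dg w]mul1r; apply: cderiv_affine.
    by rewrite mulr0 add0r.
  have hB z : `|Im (h z)| <= 8 * M * normc w by rewrite /h mul1r incr.
  apply/eqP; rewrite -subr_eq0; apply/eqP/(@Normc.eq0_normc R)/eqP.
  rewrite eq_le normc_ge0 andbT; apply/ler_addgt0Pr => e e0; rewrite add0r.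
  have B0 : 0 <= 8 * M * normc w by rewrite !mulr_ge0 // normc_ge0.
  move: (8 * M * normc w) hB B0 => N hB B0.
    (* Im h is bounded by N, so letting the radius grow makes its derivative as
     small as desired. *)
  have r0 : 0 < (8 * N + 1) / e by rewrite divr_gt0 // ltr_wpDl // mulr_ge0.
  apply: le_trans (@cderiv_estimate h 0 _ _ (2 * N) hh dh r0 _) _.
    move=> z _; rewrite raddfB; apply: le_trans (ler_normB _ _) _.
    have -> : 2 * N = N + N by ring.
    exact: lerD (hB _) (hB _).
  have N1 : 0 < 8 * N + 1 by rewrite ltr_wpDl // mulr_ge0.
  have -> : 4 * (2 * N) / ((8 * N + 1) / e) = e * (8 * N / (8 * N + 1)).
    by field; rewrite !gt_eqF.
  by rewrite ler_piMr ?(ltW e0) // ler_pdivrMr // mul1r lerDl.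
exists (g 0), (dg 0) => z; apply/eqP; rewrite -subr_eq.
have := @cderiv0_cst R (fun z => g z - dg 0 * z).
rewrite mulr0 subr0 => -> // {}z.
have d0 : cderiv (fun=> dg 0) z 0 by exact: (@is_derive_cst C C^o C^o).
have d1 : cderiv (fun z : C => z) z 1 by exact: (@is_derive_id C C^o).
have := cderivB (gd z) (cderivM d0 d1).
by rewrite mulr1 mulr0 addr0 dg_cst subrr.
Qed.

End Entire.

(** * Quaternions in coordinates *)

Section QuatCoordinates.
Variable K : comNzRingType.
Implicit Types (x y : quat K) (a : K).

Lemma quatNE : (forall x, quat0 (- x) = - quat0 x) *
  (forall x, quat1 (- x) = - quat1 x) * (forall x, quat2 (- x) = - quat2 x) *
  (forall x, quat3 (- x) = - quat3 x).
Proof. by do !split=> [|x]; move=> *; exact: mxE. Qed.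

Lemma quatZE : (forall a x, quat0 (a *: x) = a * quat0 x) *
  (forall a x, quat1 (a *: x) = a * quat1 x) *
  (forall a x, quat2 (a *: x) = a * quat2 x) *
  (forall a x, quat3 (a *: x) = a * quat3 x).
Proof. by do !split; move=> *; exact: mxE. Qed.

Lemma quatME : (forall x y, quat0 (x * y) =
    quat0 x * quat0 y - quat1 x * quat1 y - quat2 x * quat2 y - quat3 x * quat3 y) *
  (forall x y, quat1 (x * y) =
    quat0 x * quat1 y + quat1 x * quat0 y + quat2 x * quat3 y - quat3 x * quat2 y) *
  (forall x y, quat2 (x * y) =
    quat0 x * quat2 y - quat1 x * quat3 y + quat2 x * quat0 y + quat3 x * quat1 y) *
  (forall x y, quat3 (x * y) =
    quat0 x * quat3 y + quat1 x * quat2 y - quat2 x * quat1 y + quat3 x * quat0 y).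
Proof. by do !split; move=> *; exact: mxE. Qed.

Lemma quat1E : (1 : quat K) = mkquat 1 0 0 0. Proof. by []. Qed.

Lemma quat_0E : (quat0 (0 : quat K) = 0) * (quat1 (0 : quat K) = 0) *
  (quat2 (0 : quat K) = 0) * (quat3 (0 : quat K) = 0).
Proof. by do !split; move=> *; exact: mxE. Qed.

Definition quatE := (quat1E, quatDE, quatNE, quatZE, quatME, quat_0E, quat_mkE).

Lemma forall_coord (P : 'I_4 -> Prop) :
  P (@Ordinal 4 0 isT) -> P (@Ordinal 4 1 isT) -> P (@Ordinal 4 2 isT) ->
  P (@Ordinal 4 3 isT) -> forall m, P m.
Proof.
move=> h0 h1 h2 h3 [[|[|[|[|m]]]] hm] //.
- by rewrite (bool_irrelevance hm isT).
- by rewrite (bool_irrelevance hm isT).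
- by rewrite (bool_irrelevance hm isT).
- by rewrite (bool_irrelevance hm isT).
Qed.

Lemma quat_scaleAl a x y : (a *: x) * y = a *: (x * y).
Proof. by apply: quatP; rewrite !quatE; ring. Qed.

Lemma quat_scaleAr a x y : x * (a *: y) = a *: (x * y).
Proof. by apply: quatP; rewrite !quatE; ring. Qed.

Lemma quat_i2 : quat_i K * quat_i K = -1.
Proof. by apply: quatP; rewrite /quat_i !quatE; ring. Qed.

Lemma quat_j2 : quat_j K * quat_j K = -1.
Proof. by apply: quatP; rewrite /quat_j !quatE; ring. Qed.

Lemma quat_k2 : quat_k K * quat_k K = -1.
Proof. by apply: quatP; rewrite /quat_k !quatE; ring. Qed.

Lemma quat_ij_anticomm : quat_i K * quat_j K = - (quat_j K * quat_i K).
Proof. by apply: quatP; rewrite /quat_i /quat_j !quatE; ring. Qed.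

Lemma quat_ik_anticomm : quat_i K * quat_k K = - (quat_k K * quat_i K).
Proof. by apply: quatP; rewrite /quat_i /quat_k !quatE; ring. Qed.

End QuatCoordinates.

(** * Slice functions determined by the growth of F_2 *)

Section SliceAffine.
Variable R : realType.
Local Notation H := (quat R).
Local Notation i := (quat_i R).
Local Notation normc := (@Normc.normc R).
Implicit Types (F : R[i] -> quat R[i]) (f : H -> H).

Lemma coord_le_quat_norm (x : H) m : `|x ord0 m| <= quat_norm x.
Proof.
move: m; apply: forall_coord;
  rewrite -sqrtr_sqr /quat_norm ler_sqrt ?/quat_sqnorm ?addr_ge0 ?sqr_ge0 //.
all: rewrite -/(quat0 x) -/(quat1 x) -/(quat2 x) -/(quat3 x).
all: have := sqr_ge0 (quat0 x); have := sqr_ge0 (quat1 x).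
all: have := sqr_ge0 (quat2 x); have := sqr_ge0 (quat3 x); lra.
Qed.

Lemma quat_norm_ge0 (x : H) : 0 <= quat_norm x.
Proof. exact: sqrtr_ge0. Qed.

(** [J] is the normalized imaginary part of [x]; for a real [x], whose
    imaginary part cannot be normalized, any unit such as [i] will do. *)
Lemma quat_polar (x : H) : exists a b (J : H), J ^+ 2 = -1 /\ x = a *: (1 : H) + b *: J.
Proof.
have [x0|x0] := eqVneq (quat_Im x) 0.
  exists (quat0 x), 0, i; split; first exact: quat_i2.
  have := congr1 (@quat1 R) x0; have := congr1 (@quat2 R) x0.
  have := congr1 (@quat3 R) x0; rewrite /quat_Im !quatE => x3 x2 x1.
  by apply: quatP; rewrite !quatE ?x1 ?x2 ?x3; ring.
have n0 : quat_norm (quat_Im x) != 0.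
  rewrite sqrtr_eq0 -ltNge lt_def quat_sqnorm_eq0 x0 /=.
  by rewrite /quat_sqnorm !addr_ge0 ?sqr_ge0.
have n2 : quat_norm (quat_Im x) ^+ 2 = quat1 x ^+ 2 + quat2 x ^+ 2 + quat3 x ^+ 2.
  rewrite sqr_sqrtr; last by rewrite /quat_sqnorm !addr_ge0 ?sqr_ge0.
  by rewrite /quat_sqnorm /quat_Im !quatE; ring.
move: (quat_norm _) n0 n2 => n n0 n2.
exists (quat0 x), n, (n^-1 *: quat_Im x); split; last first.
  by rewrite scalerA divff // scale1r; apply: quatP; rewrite /quat_Im !quatE; ring.
rewrite expr2 quat_scaleAl quat_scaleAr scalerA -expr2 exprVn n2.
have n3 : quat1 x ^+ 2 + quat2 x ^+ 2 + quat3 x ^+ 2 != 0 by rewrite -n2 sqrf_eq0.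
by apply: quatP; rewrite /quat_Im !quatE; field.
Qed.

Lemma entire_coord F m : holomorphic_stem F -> entire (fun z => F z ord0 m).
Proof.
move=> hF z; have D1 := (derivable1_diffP (F : R[i]^o -> _) z).1 (hF z).
have D2 := @differentiable_coord R[i] 1 4 (F z) ord0 m.
have D := @differentiable_comp R[i] R[i]^o _ R[i]^o F
  (fun N : 'M[R[i]]_(1, 4) => N ord0 m) z D1 D2.
by eexists; apply/derivableP/(derivable1_diffP _ _).2; exact: D.
Qed.

Lemma stem_conjE F m z : is_stem F -> F (conjc z) ord0 m = conjc (F z ord0 m).
Proof. by move=> ->; rewrite mxE. Qed.

Lemma stem_fstE F m z : stem_fst F z ord0 m = Re (F z ord0 m).
Proof. by rewrite mxE. Qed.

Lemma stem_sndE F m z : stem_snd F z ord0 m = Im (F z ord0 m).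
Proof. by rewrite mxE. Qed.

Lemma stem_snd_conj F x y : is_stem F ->
  stem_snd F (Complex x (- y)) = - stem_snd F (Complex x y).
Proof.
move=> hF; apply/rowP => m; rewrite [RHS]mxE !stem_sndE.
by rewrite -[Complex x (- y)]/(conjc (Complex x y)) stem_conjE //; case: (F _ _ _).
Qed.

(** Each coordinate is [a_m + c_m z]; compatibility with conjugation at [z = 0]
    and [z = 1] makes [a_m] and [c_m] real. *)
Lemma stem_affine F (M : R) : is_stem F -> holomorphic_stem F ->
  (forall z m, `|stem_snd F z ord0 m| <= M * (1 + normc z)) ->
  exists a b : H, forall x y,
    stem_fst F (Complex x y) = a + x *: b /\ stem_snd F (Complex x y) = y *: b.
Proof.
move=> sF hF hM.
have /choice [ab abP] m : exists ab : R[i] * R[i],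
    forall z, F z ord0 m = ab.1 + ab.2 * z.
  have [|a [b ab]] := @Im_growth_affine R _ M (entire_coord m hF).
    by move=> z; rewrite -stem_sndE.
  by exists (a, b).
have aR m : Im (ab m).1 = 0.
  have := stem_conjE m 0 sF; rewrite conjc0 !abP mulr0 addr0.
  by case: (ab m).1 => u v [] /=; lra.
have bR m : Im (ab m).2 = 0.
  have := stem_conjE m 1 sF; rewrite conjc1 !abP mulr1; have := aR m.
  by case: (ab m) => [[u v] [u' v']] /= -> []; lra.
exists (\row_m Re (ab m).1), (\row_m Re (ab m).2) => x y.
split; apply/rowP => m; rewrite ?stem_fstE ?stem_sndE !mxE abP.
- move: (aR m) (bR m); case: (ab m) => [[u v] [u' v']] /= _ ->; ring.
- move: (aR m) (bR m); case: (ab m) => [[u v] [u' v']] /= -> ->; ring.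
Qed.

Lemma slice_affine F f (M : R) : is_stem F -> holomorphic_stem F ->
  is_slice_of F f ->
  (forall z m, `|stem_snd F z ord0 m| <= M * (1 + normc z)) ->
  exists a b : H, forall x, f x = a + x * b.
Proof.
move=> sF hF Ff hM; have [a [b ab]] := stem_affine sF hF hM.
exists a, b => x; have [u [v [J [J2 ->]]]] := quat_polar x.
rewrite Ff //; have [-> ->] := ab u v.
by rewrite mulrDl !quat_scaleAl mul1r quat_scaleAr addrA.
Qed.

Lemma half_diff (u v : H) : 2^-1 *: (u + v - (u - v)) = v.
Proof. by apply: quatP; rewrite !quatE; field. Qed.

(** Evaluating [f] at [x + y i] and [x + y (- i)], which share the same point of
    the complex plane, isolates [i F_2]. *)
Lemma bounded_stem_snd F f (M : R) : is_slice_of F f ->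
  (forall x, quat_norm (f x) <= M) ->
  forall z m, `|stem_snd F z ord0 m| <= M.
Proof.
move=> Ff hM [x y].
set w := stem_snd F _.
pose q := 2^-1 *: (f (x *: (1 : H) + y *: i) - f (x *: (1 : H) + y *: (- i))).
have qE : q = i * w.
  rewrite /q !Ff ?sqrrN ?expr2 ?quat_i2 //.
  by rewrite mulNr half_diff.
(* Multiplication by i permutes coordinates up to sign. *)
have wE : w = - (i * q) by rewrite qE mulrA quat_i2 mulN1r opprK.
have qM m : `|q ord0 m| <= M.
  rewrite !mxE normrM ger0_norm ?invr_ge0 // mulrC ler_pdivrMr //.
  apply: le_trans (ler_normB _ _) _; rewrite mulrC mulr_natl mulr2n.
  by apply: lerD; apply: le_trans (coord_le_quat_norm _ _) (hM _).
have w0 : quat0 w = quat1 q by rewrite wE /quat_i !quatE; ring.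
have w1 : quat1 w = - quat0 q by rewrite wE /quat_i !quatE; ring.
have w2 : quat2 w = quat3 q by rewrite wE /quat_i !quatE; ring.
have w3 : quat3 w = - quat2 q by rewrite wE /quat_i !quatE; ring.
by apply: forall_coord; rewrite -?[w _ _]/(quat0 w) -?[w _ _]/(quat1 w)
  -?[w _ _]/(quat2 w) -?[w _ _]/(quat3 w) ?w0 ?w1 ?w2 ?w3 ?normrN; exact: qM.
Qed.

(** On the real axis [f] is [a + t b], unbounded in any coordinate where [b] does
    not vanish. *)
Lemma bounded_affine_cst f (a b : H) : quat_bounded f ->
  (forall x, f x = a + x * b) -> b = 0.
Proof.
move=> [M hM] ab; apply/rowP => m; rewrite [RHS]mxE.
apply/eqP; apply: contraT => b0.
pose t := (M + `|a ord0 m| + 1) / b ord0 m.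
have := le_trans (coord_le_quat_norm _ m) (hM (t *: (1 : H))).
rewrite ab quat_scaleAl mul1r !mxE /t divfK // => h.
have := ler_norm (M + `|a ord0 m| + 1); have := ler_norm (- a ord0 m).
have := ler_norm (a ord0 m + (M + `|a ord0 m| + 1)); rewrite normrN; lra.
Qed.

Lemma sderiv_nonrealP f (x : H) : quat_Im x != 0 ->
  quat_Im x * sderiv_nonreal f x = 2^-1 *: (f x - f (quat_conj x)).
Proof.
by move=> x0; rewrite /sderiv_nonreal quat_scaleAr mulrA divrr // mul1r.
Qed.

(** One imaginary unit is enough to recover [F_2] from the spherical derivative. *)
Lemma stem_snd_spherical F f x y : is_slice_of F f -> y != 0 ->
  stem_snd F (Complex x y) = y *: spherical_derivative f (x *: (1 : H) + y *: i).
Proof.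
move=> Ff y0.
have ImE : quat_Im (x *: (1 : H) + y *: i) = y *: i.
  by apply: quatP; rewrite /quat_Im /quat_i !quatE; ring.
have cE : quat_conj (x *: (1 : H) + y *: i) = x *: (1 : H) + y *: (- i).
  by apply: quatP; rewrite /quat_conj /quat_i !quatE; ring.
have I0 : quat_Im (x *: (1 : H) + y *: i) != 0.
  rewrite ImE; apply: contra y0 => /eqP/(congr1 (@quat1 R)).
  by rewrite /quat_i !quatE mulr1 => ->.
rewrite /spherical_derivative (negbTE I0).
have := sderiv_nonrealP f I0; rewrite ImE cE !Ff ?sqrrN ?expr2 ?quat_i2 //.
rewrite mulNr half_diff quat_scaleAl => /(congr1 (fun q => - (i * q))).
by rewrite quat_scaleAr !mulrA quat_i2 !mulN1r scalerN !opprK => ->.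
Qed.

Lemma stem_snd_real F x : is_stem F -> stem_snd F (Complex x 0) = 0.
Proof.
move=> sF; have := stem_snd_conj x 0 sF; rewrite oppr0 => /eqP.
by rewrite -addr_eq0 -mulr2n -scaler_nat scaler_eq0 pnatr_eq0 => /eqP.
Qed.

Lemma spherical_stem_snd F f (M : R) : is_stem F -> is_slice_of F f ->
  (forall x, quat_norm (spherical_derivative f x) <= M) ->
  forall z m, `|stem_snd F z ord0 m| <= M * (1 + normc z).
Proof.
move=> sF Ff hM z m.
have M0 : 0 <= M := le_trans (quat_norm_ge0 _) (hM 0).
apply: (@le_trans _ _ (M * `|Im z|)); last first.
  by rewrite ler_wpM2l //; apply: le_trans (Im_le_normc z) _; rewrite lerDr.
case: z => x y /=; have [->|y0] := eqVneq y 0.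
  by rewrite stem_snd_real // mxE normr0 mulr0.
rewrite (stem_snd_spherical _ Ff) // mxE normrM mulrC ler_wpM2r //.
exact: le_trans (coord_le_quat_norm _ _) (hM _).
Qed.

Lemma sderiv_affine f (a b x : H) : (forall x, f x = a + x * b) ->
  quat_Im x != 0 -> sderiv_nonreal f x = b.
Proof.
move=> ab x0; rewrite /sderiv_nonreal !ab.
have -> : a + x * b - (a + quat_conj x * b) = 2 *: (quat_Im x * b).
  by apply: quatP; rewrite /quat_Im /quat_conj !quatE; ring.
rewrite quat_scaleAr mulrA mulVr // mul1r scalerA mulVf ?scale1r //.
Qed.

(** Makes the filter that defines the spherical derivative at a real point proper,
    so that limits along it are unique. *)
Lemma nonreal_dense (x : H) : closure [set y : H | quat_Im y != 0] x.
Proof.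
have [x0|x0] := eqVneq (quat_Im x) 0; last exact: subset_closure.
move=> A /nbhs_ballP [e /= e0 eA].
have i1 : 0 < `|i| + 1 by rewrite ltr_wpDl.
have t0 : 0 < e / (`|i| + 1) by rewrite divr_gt0.
exists (x + (e / (`|i| + 1)) *: i); split => /=.
  apply: contraTN t0 => /eqP/(congr1 (@quat1 R)).
  have := congr1 (@quat1 R) x0.
  by rewrite /quat_Im /quat_i !quatE mulr1 => ->; rewrite add0r => ->; rewrite ltxx.
apply: eA; rewrite -ball_normE /ball_ /= opprD addrA subrr sub0r normrN normrZ.
by rewrite gtr0_norm // mulrAC ltr_pdivrMr // ltr_pM2l // ltrDl.
Qed.

Lemma spherical_affine f (a b : H) : (forall x, f x = a + x * b) ->
  forall x, spherical_derivative f x = b.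
Proof.
move=> ab x; rewrite /spherical_derivative; case: ifPn => x0; last first.
  exact: sderiv_affine ab x0.
have pf : ProperFilter (within [set y : H | quat_Im y != 0] (nbhs x)).
  exact/within_nbhs_proper/nonreal_dense.
apply: cvg_lim; first exact: norm_hausdorff.
apply: cvg_near_cst; near=> y; apply: sderiv_affine ab _.
by near: y; exact: withinT.
Unshelve. all: by end_near.
Qed.

End SliceAffine.

(** * The Cauchy-Riemann-Fueter operator on slice functions *)

(** A directional derivative is the derivative at [0] of a curve, for which the
    calculus of functions of one real variable is available. *)
Lemma is_derive_lineP (K : numFieldType) (U V : normedModType K) (f : U -> V) x v l :
  is_derive x v f l <-> is_derive (0 : K) (1 : K) (fun h : K => f (x + h *: v)) l.
Proof.
split=> /is_deriveP fl; apply/is_deriveP => e /fl [d d0 D]; exists d => // h /D.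
- by rewrite add0r scale0r addr0 [h *: 1]mulr1.
- by rewrite add0r scale0r addr0 [h *: 1]mulr1.
Qed.

Section DbarCRF.
Variable R : realType.
Local Notation H := (quat R).
Local Notation i := (quat_i R).
Local Notation j := (quat_j R).
Local Notation k := (quat_k R).
Implicit Types (F : R[i] -> quat R[i]) (f : H -> H).

(** Derivatives of curves in the quaternions are handled coordinatewise, where
    products and compositions are those of real functions. *)
Definition curve_deriv (phi : R -> H) (t : R) (l : H) : Prop :=
  forall m, is_derive t 1 (fun h => phi h ord0 m) (l ord0 m).

Lemma curve_deriv_D f x v l :
  curve_deriv (fun h => f (x + h *: v)) 0 l -> 'D_v f x = l.
Proof.
move=> fl.
have fm m : is_derive x v (fun y => f y ord0 m) (l ord0 m) by exact/is_derive_lineP.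
have df : derivable (f : H -> 'M[R]_(1, 4)) x v.
  by apply/derivable_mxP => n m; rewrite (ord1 n); have [] := fm m.
have -> : 'D_v f x = 'D_v (f : H -> 'M[R]_(1, 4)) x by [].
rewrite derive_mx //; apply/rowP => m; rewrite mxE.
by have [_ ->] := fm m.
Qed.

Lemma curve_derivD phi psi t l m : curve_deriv phi t l -> curve_deriv psi t m ->
  curve_deriv (fun h => phi h + psi h) t (l + m).
Proof.
move=> hl hm n; rewrite mxE.
have -> : (fun h => (phi h + psi h) ord0 n) = (fun h => phi h ord0 n + psi h ord0 n).
  by apply/funext => h; rewrite mxE.
exact: is_deriveD.
Qed.

Lemma curve_derivMl (c : H) phi t l : curve_deriv phi t l ->
  curve_deriv (fun h => c * phi h) t (c * l).
Proof.
move=> hl.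
have h0 : is_derive t 1 (fun h => quat0 (phi h)) (quat0 l) by exact: hl.
have h1 : is_derive t 1 (fun h => quat1 (phi h)) (quat1 l) by exact: hl.
have h2 : is_derive t 1 (fun h => quat2 (phi h)) (quat2 l) by exact: hl.
have h3 : is_derive t 1 (fun h => quat3 (phi h)) (quat3 l) by exact: hl.
apply: forall_coord.
- rewrite -[(c * l) _ _]/(quat0 (c * l)) quatME.
  have -> : (fun h => (c * phi h) ord0 (@Ordinal 4 0 isT)) =
    (fun h => quat0 c * quat0 (phi h) - quat1 c * quat1 (phi h)
        - quat2 c * quat2 (phi h) - quat3 c * quat3 (phi h)).
    by apply/funext => h; rewrite -quatME.
  exact: (is_deriveB (is_deriveB (is_deriveB (is_deriveZ (quat0 c) h0)
    (is_deriveZ (quat1 c) h1)) (is_deriveZ (quat2 c) h2)) (is_deriveZ (quat3 c) h3)).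
- rewrite -[(c * l) _ _]/(quat1 (c * l)) quatME.
  have -> : (fun h => (c * phi h) ord0 (@Ordinal 4 1 isT)) =
    (fun h => quat0 c * quat1 (phi h) + quat1 c * quat0 (phi h)
        + quat2 c * quat3 (phi h) - quat3 c * quat2 (phi h)).
    by apply/funext => h; rewrite -quatME.
  exact: (is_deriveB (is_deriveD (is_deriveD (is_deriveZ (quat0 c) h1)
    (is_deriveZ (quat1 c) h0)) (is_deriveZ (quat2 c) h3)) (is_deriveZ (quat3 c) h2)).
- rewrite -[(c * l) _ _]/(quat2 (c * l)) quatME.
  have -> : (fun h => (c * phi h) ord0 (@Ordinal 4 2 isT)) =
    (fun h => quat0 c * quat2 (phi h) - quat1 c * quat3 (phi h)
        + quat2 c * quat0 (phi h) + quat3 c * quat1 (phi h)).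
    by apply/funext => h; rewrite -quatME.
  exact: (is_deriveD (is_deriveD (is_deriveB (is_deriveZ (quat0 c) h2)
    (is_deriveZ (quat1 c) h3)) (is_deriveZ (quat2 c) h0)) (is_deriveZ (quat3 c) h1)).
- rewrite -[(c * l) _ _]/(quat3 (c * l)) quatME.
  have -> : (fun h => (c * phi h) ord0 (@Ordinal 4 3 isT)) =
    (fun h => quat0 c * quat3 (phi h) + quat1 c * quat2 (phi h)
        - quat2 c * quat1 (phi h) + quat3 c * quat0 (phi h)).
    by apply/funext => h; rewrite -quatME.
  exact: (is_deriveD (is_deriveB (is_deriveD (is_deriveZ (quat0 c) h3)
    (is_deriveZ (quat1 c) h2)) (is_deriveZ (quat2 c) h1)) (is_deriveZ (quat3 c) h0)).
Qed.

Lemma curve_deriv_scale (a : R -> R) (phi : R -> H) (t a' : R) (l : H) :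
  is_derive t 1 a a' ->
  curve_deriv phi t l ->
  curve_deriv (fun h => a h *: phi h) t (a t *: l + a' *: phi t).
Proof.
move=> ha hl n; rewrite !mxE [a' * _]mulrC.
have -> : (fun h => (a h *: phi h) ord0 n) = (fun h => a h * phi h ord0 n).
  by apply/funext => h; rewrite mxE.
exact: (is_deriveM ha (hl n)).
Qed.

(** Only a critical point [t] of [s] is considered: this is the situation of the
    modulus of the imaginary part when moving orthogonally to it. *)
Lemma curve_deriv_comp (phi : R -> H) (s : R -> R) (t : R) (l : H) :
  curve_deriv phi (s t) l ->
  is_derive t 1 s 0 -> curve_deriv (fun h => phi (s h)) t 0.
Proof.
move=> hl hs n; rewrite mxE -(mulr0 (l ord0 n)).
exact: (is_derive1_comp (hl n) hs).
Qed.

Lemma stem_line_deriv F (z d : R[i]) (t : R) (c : 'I_4 -> R[i]) :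
  (forall m, cderiv (fun z => F z ord0 m) (z + t%:C * d) (c m)) ->
  curve_deriv (fun h => stem_fst F (z + h%:C * d)) t (\row_m Re (c m * d)) /\
  curve_deriv (fun h => stem_snd F (z + h%:C * d)) t (\row_m Im (c m * d)).
Proof.
move=> hc; split=> m; rewrite mxE.
- have -> : (fun h => stem_fst F (z + h%:C * d) ord0 m) =
    (fun h : R => Re (1 * F (z + h%:C * d) ord0 m)).
    by apply/funext => h; rewrite stem_fstE mul1r.
  by rewrite -[c m * d]mul1r; exact: (cderiv_Re_line 1 (hc m)).
- have ImE (u : R[i]) : Im u = Re (Complex 0 (-1) * u).
    by case: u => a b /=; ring.
  have -> : (fun h => stem_snd F (z + h%:C * d) ord0 m) =
    (fun h : R => Re (Complex 0 (-1) * F (z + h%:C * d) ord0 m)).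
    by apply/funext => h; rewrite stem_sndE ImE.
  by rewrite ImE; exact: (cderiv_Re_line (Complex 0 (-1)) (hc m)).
Qed.

(** Along the slice of [i] the imaginary unit is fixed, so [f] is differentiated by
    differentiating [F] in the direction [u + iota v]. *)
Lemma slice_deriv_tangent F f x y (u v : R) (c : 'I_4 -> R[i]) :
  is_slice_of F f ->
  (forall m, cderiv (fun z => F z ord0 m) (Complex x y) (c m)) ->
  'D_(u *: (1 : H) + v *: i) f (x *: (1 : H) + y *: i) =
  (\row_m Re (c m * Complex u v)) + i * (\row_m Im (c m * Complex u v)).
Proof.
move=> Ff hc; apply: curve_deriv_D.
have [|d1 d2] := @stem_line_deriv F (Complex x y) (Complex u v) 0 c.
  by move=> m; rewrite mul0r addr0.
have := curve_derivD d1 (curve_derivMl i d2).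
congr (curve_deriv _ _ _); apply/funext => h.
have -> : x *: (1 : H) + y *: i + h *: (u *: (1 : H) + v *: i) =
  (x + h * u) *: (1 : H) + (y + h * v) *: i.
  by rewrite scalerDr !scalerA addrACA -!scalerDl.
rewrite Ff ?expr2 ?quat_i2 //.
have -> // : Complex x y + h%:C * Complex u v = Complex (x + h * u) (y + h * v).
by apply/eqP; rewrite eq_complex /=; apply/andP; split; apply/eqP; ring.
Qed.

(** Moving orthogonally to the imaginary part of a point leaves its length fixed
    at first order. *)
Lemma is_derive_hypot (y : R) : 0 < y ->
  is_derive (0 : R) 1 (fun h => Num.sqrt (y ^+ 2 + h ^+ 2)) 0.
Proof.
move=> y0.
have d1 : is_derive (0 : R) 1 (fun h => y ^+ 2 + h ^+ 2) 0.
  apply/is_deriveP => e e0; exists e => // h he.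
  rewrite add0r expr0n /= addr0 [h *: 1]mulr1 scaler0 subr0 addrAC subrr add0r.
  by rewrite expr2 normrM ler_wpM2r // ltW.
have d2 : is_derive (y ^+ 2 + 0 ^+ 2) 1 Num.sqrt (2 * Num.sqrt (y ^+ 2 + 0 ^+ 2))^-1.
  by apply: is_derive1_sqrt; rewrite expr0n addr0 exprn_gt0.
have := @is_derive1_comp R Num.sqrt (fun h => y ^+ 2 + h ^+ 2) 0 _ _ d2 d1.
by rewrite mulr0.
Qed.

(** At [x + y i + h v] the imaginary part has length [s h], with [s' 0 = 0], so the
    value of [f] is
    [F_1(x, s h) + (y i + h v) (F_2(x, s h) / s h)]; at first order the only
    change comes from the factor [h v]. *)
Lemma slice_deriv_normal F f x y (v : H) :
  holomorphic_stem F -> is_slice_of F f -> 0 < y ->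
  v * v = -1 -> i * v = - (v * i) ->
  'D_v f (x *: (1 : H) + y *: i) = v * (y^-1 *: stem_snd F (Complex x y)).
Proof.
move=> hF Ff y0 v2 iv; apply: curve_deriv_D.
pose s (h : R) := Num.sqrt (y ^+ 2 + h ^+ 2).
have ds : is_derive (0 : R) 1 s 0 by exact: is_derive_hypot.
have s0 : s 0 = y by rewrite /s expr0n addr0 sqrtr_sqr gtr0_norm.
have sE h : s h ^+ 2 = y ^+ 2 + h ^+ 2 by rewrite sqr_sqrtr // addr_ge0 ?sqr_ge0.
have sn0 h : s h != 0.
  by rewrite -sqrf_eq0 sE gt_eqF // ltr_wpDr ?sqr_ge0 // exprn_gt0.
have [c hc] := choice (fun m => entire_coord m hF (Complex x 0 + y%:C * Complex 0 1)).
have [d1 d2] := stem_line_deriv hc.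
have lineE t : Complex x 0 + t%:C * Complex 0 1 = Complex x t.
  by apply/eqP; rewrite eq_complex /=; apply/andP; split; apply/eqP; ring.
have dinv : is_derive y 1 (fun t : R => t^-1) ('D_1 (fun t : R => t^-1) y).
  by apply/derivableP/derivableV; [rewrite gt_eqF|exact: derivable_id].
have d3 := curve_deriv_scale dinv d2.
rewrite -s0 in d1 d3.
have e1 := curve_deriv_comp d1 ds; have e3 := curve_deriv_comp d3 ds.
have idd : is_derive (0 : R) 1 (fun h : R => h) 1 by exact: is_derive_id.
have cd : is_derive (0 : R) 1 (fun h : R => y) 0 by exact: is_derive_cst.
have := curve_derivD e1 (curve_derivD
  (curve_derivMl i (curve_deriv_scale cd e3))
  (curve_derivMl v (curve_deriv_scale idd e3))).
rewrite !scaler0 !scale0r !addr0 mulr0 !add0r scale1r s0 lineE.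
congr (curve_deriv _ _ _); apply/funext => h; rewrite lineE.
have -> : x *: (1 : H) + y *: i + h *: v =
  x *: (1 : H) + s h *: ((s h)^-1 *: (y *: i + h *: v)).
  by rewrite scalerA divff // scale1r addrA.
rewrite Ff; last first.
  rewrite expr2 quat_scaleAl quat_scaleAr scalerA -expr2 exprVn sE.
  have -> : (y *: i + h *: v) * (y *: i + h *: v) = (y ^+ 2 + h ^+ 2) *: (-1 : H).
    rewrite mulrDl !mulrDr !quat_scaleAl !quat_scaleAr quat_i2 v2 iv.
    by move: (v * i) => w; apply/rowP => m; rewrite !mxE; ring.
  by rewrite scalerA mulVf ?scale1r // -sE sqrf_eq0.
congr (_ + _); rewrite quat_scaleAl -quat_scaleAr mulrDl !quat_scaleAl.
by rewrite !quat_scaleAr.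
Qed.

(** The tangential derivatives are [P + i Q] and [- Q + i P], and
    [P + i Q + i (- Q + i P) = 0]; what remains are the two normal directions. *)
Lemma dbar_CRF_slice F f x y :
  holomorphic_stem F -> is_slice_of F f -> 0 < y ->
  dbar_CRF f (x *: (1 : H) + y *: i) = (- 2 / y) *: stem_snd F (Complex x y).
Proof.
move=> hF Ff y0; rewrite /dbar_CRF.
have [c hc] := choice (fun m => entire_coord m hF (Complex x y)).
have -> : 'D_1 f (x *: (1 : H) + y *: i) = (\row_m Re (c m)) + i * (\row_m Im (c m)).
  have := slice_deriv_tangent 1 0 Ff hc; rewrite scale1r scale0r addr0 => ->.
  by congr (_ + i * _); apply/rowP => m; rewrite !mxE mulr1.
have -> : 'D_i f (x *: (1 : H) + y *: i) = - (\row_m Im (c m)) + i * (\row_m Re (c m)).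
  have := slice_deriv_tangent 0 1 Ff hc; rewrite scale1r scale0r add0r => ->.
  by congr (_ + i * _); apply/rowP => m; rewrite !mxE; case: (c m) => a b /=; ring.
rewrite (slice_deriv_normal x hF Ff y0 (quat_j2 R) (quat_ij_anticomm R)).
rewrite (slice_deriv_normal x hF Ff y0 (quat_k2 R) (quat_ik_anticomm R)).
move: (\row_m Re (c m)) (\row_m Im (c m)) (stem_snd F _) => P Q S.
rewrite mulrDr mulrN [i * (i * _)]mulrA [j * (j * _)]mulrA [k * (k * _)]mulrA.
rewrite quat_i2 quat_j2 quat_k2 !mulN1r; move: (i * Q) => iQ.
by apply/rowP => m; rewrite !mxE; ring.
Qed.

End DbarCRF.

Section BoundedCRF.
Variable R : realType.
Local Notation H := (quat R).
Local Notation normc := (@Normc.normc R).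
Implicit Types (F : R[i] -> quat R[i]) (f : H -> H).

(** [dbar_CRF_slice] gives the bound for [y > 0]; since [F_2] is odd in [y], it
    extends to [y < 0] and to [y = 0], where [F_2] vanishes. *)
Lemma dbar_CRF_stem_snd F f (M : R) :
  is_stem F -> holomorphic_stem F -> is_slice_of F f ->
  (forall x, quat_norm (dbar_CRF f x) <= M) ->
  forall z m, `|stem_snd F z ord0 m| <= M * (1 + normc z).
Proof.
move=> sF hF Ff hM.
have M0 : 0 <= M := le_trans (quat_norm_ge0 _) (hM 0).
have upper x y m : 0 < y -> `|stem_snd F (Complex x y) ord0 m| <= M * y.
  move=> y0; have -> : stem_snd F (Complex x y) =
      - (y / 2) *: dbar_CRF f (x *: (1 : H) + y *: quat_i R).
    rewrite (dbar_CRF_slice x hF Ff y0) scalerA.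
    have -> : - (y / 2) * (- 2 / y) = 1 by field; rewrite gt_eqF.
    by rewrite scale1r.
  have y2 : 0 <= y / 2 by rewrite divr_ge0 // ltW.
  rewrite mxE normrM normrN (ger0_norm y2) mulrC.
  apply: ler_pM => //.
    exact: le_trans (coord_le_quat_norm _ _) (hM _).
  by rewrite ler_pdivrMr // ler_peMr ?(ltW y0) // ler1n.
move=> z m; apply: (@le_trans _ _ (M * `|Im z|)); last first.
  by rewrite ler_wpM2l //; apply: le_trans (Im_le_normc z) _; rewrite lerDr.
case: z => x y /=; have [y0|y0|->] := ltrgt0P y.
- exact: upper.
- rewrite -[X in Complex x X]opprK.
  by rewrite stem_snd_conj // mxE normrN upper // oppr_gt0.
- by rewrite stem_snd_real // mxE normr0 mulr0.
Qed.

Lemma dbar_CRF_affine f (a b : H) : (forall x, f x = a + x * b) ->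
  forall x, dbar_CRF f x = -2 *: b.
Proof.
move=> ab x.
have Dv v : 'D_v f x = v * b.
  suff [_ ->] : is_derive x v f (v * b) by [].
  apply/is_deriveP => e e0; exists e => // h _.
  have -> : f (x + h *: v) - f x - h *: (v * b) = 0.
    by rewrite !ab mulrDl quat_scaleAl addrA (addrC _ (h *: _)) addrK subrr.
  by rewrite normr0 mulr_ge0 // ltW.
rewrite /dbar_CRF !Dv !mulrA quat_i2 quat_j2 quat_k2 mul1r !mulN1r.
by apply/rowP => m; rewrite !mxE; ring.
Qed.

End BoundedCRF.

Theorem corollary6p8 (R : realType) (f : quat R -> quat R)
    (hf : entire_slice_regular f) :
  (quat_bounded f -> exists c : quat R, forall x : quat R, f x = c) /\
  (quat_bounded (spherical_derivative f) <-> quat_bounded (dbar_CRF f)) /\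
  (quat_bounded (spherical_derivative f) ->
     exists a b : quat R, forall x : quat R, f x = a + x * b).
Proof.
have [F [sF hF Ff]] := hf.
have affine_of_sderiv : quat_bounded (spherical_derivative f) ->
    exists a b : quat R, forall x, f x = a + x * b.
  by move=> [M hM]; apply: slice_affine sF hF Ff (spherical_stem_snd sF Ff hM).
split; [|split=> //; split].
- move=> bf; have [M hM] := bf.
  have M0 : 0 <= M := le_trans (quat_norm_ge0 _) (hM 0).
  have [|a [b ab]] := @slice_affine R F f M sF hF Ff.
    move=> z m; apply: le_trans (bounded_stem_snd Ff hM z m) _.
    by rewrite ler_peMr // lerDl normc_ge0.
  by exists a => x; rewrite ab (bounded_affine_cst bf ab) mulr0 addr0.
- move=> /affine_of_sderiv [a [b ab]]; exists (quat_norm (-2 *: b)) => x.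
  by rewrite (dbar_CRF_affine ab).
- move=> [M hM].
  have [a [b ab]] := slice_affine sF hF Ff (dbar_CRF_stem_snd sF hF Ff hM).
  by exists (quat_norm b) => x; rewrite (spherical_affine ab).
Qed.
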